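(* Let $H$ be a real Hilbert space and let $A$ be a self-adjoint linear operator on $H$ with dense domain $D(A)$. Assume that there exist a countable orthonormal basis $\{e_k\}_{k\in\mathbb{N}}$ of $H$ and a (strictly) increasing sequence $\{\lambda_k\}_{k\in\mathbb{N}}$ of positive real numbers such that $Ae_k=\lambda_k^2 e_k$ for every $k\in\mathbb{N}$. Let $u_0\in D(A^{1/2})$, $u_1\in H$, and let $u(t)$ be the unique global weak solution to $$u''(t)+|u'(t)|^2u'(t)+Au(t)=0,\qquad u(0)=u_0,\quad u'(0)=u_1 .$$ Let $u_{0k}$, $u_{1k}$, $u_k(t)$ denote the components of $u_0$, $u_1$, $u(t)$ with respect to the basis $\{e_k\}$, and let $$J:=\{k\in\mathbb{N}: u_{1k}^2+u_{0k}^2\neq 0\}.$$ Then the following hold. (1) (Trivial solution) If $J=\emptyset$, then $u(t)=0$ for every $t\ge 0$, and in particular $$\lim_{t\to+\infty}t\left(|u'(t)|^2+|A^{1/2}u(t)|^2\right)=0.$$ (2) (Finite dimensional modes) If $J$ is a (nonempty) finite set with $j$ elements, then $u_k(t)=0$ for every $t\ge 0$ and every $k\notin J$. In addition, for every $k\in J$ there exists a real number $\theta_{k,\infty}$ such that $$\lim_{t\to+\infty}\left(\sqrt{t}\,u_k(t)-\frac{2}{\sqrt{2j+1}}\cdot\frac{\cos(\lambda_k t+\theta_{k,\infty})}{\lambda_k}\right)=0,$$ $$\lim_{t\to+\infty}\left(\sqrt{t}\,u_k'(t)+\frac{2}{\sqrt{2j+1}}\cdot\sin(\lambda_k t+\theta_{k,\infty})\right)=0,$$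 and in particular $$\lim_{t\to+\infty}t\left(|u'(t)|^2+|A^{1/2}u(t)|^2\right)=\frac{4j}{2j+1}.$$ (3) (Infinite dimensional modes) If $J$ is infinite, then $$\lim_{t\to+\infty}t\left(|u_k'(t)|^2+\lambda_k^2|u_k(t)|^2\right)=0\qquad\forall k\in\mathbb{N},$$ but $$\liminf_{t\to+\infty}t\left(|u'(t)|^2+|A^{1/2}u(t)|^2\right)>0,$$ and hence $\sqrt{t}\cdot(u(t),u'(t))$ converges to $(0,0)$ weakly but not strongly in $D(A^{1/2})\times H$ as $t\to+\infty$.
   Context: $|x|$ denotes the norm of $x\in H$ and $\langle x,y\rangle$ the scalar product. $A$ is self-adjoint, i.e. it is the diagonal operator with $D(A)=\{x\in H:\sum_k\lambda_k^4\langle x,e_k\rangle^2<\infty\}$; correspondingly $D(A^{1/2})=\{x\in H:\sum_k\lambda_k^2\langle x,e_k\rangle^2<\infty\}$ and $|A^{1/2}x|^2=\sum_k\lambda_k^2\langle x,e_k\rangle^2$. It is standard that for every $(u_0,u_1)\in D(A^{1/2})\times H$ the Cauchy problem has a unique weak global solution $u\in C^1([0,+\infty),H)\cap C^0([0,+\infty),D(A^{1/2}))$, and that the energy $E(t)=|u'(t)|^2+|A^{1/2}u(t)|^2$ is of class $C^1$ with $E'(t)=-2|u'(t)|^4$ for all $t\ge 0$. In components, the equation reads $u_k''(t)+|u'(t)|^2u_k'(t)+\lambda_k^2u_k(t)=0$ for every $k$, where $|u'(t)|^2=\sum_i|u_i'(t)|^2$. *)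

(* Defs.v *)
From HB Require Import structures.
From mathcomp Require Import all_boot all_order all_algebra.
From mathcomp Require Import all_classical all_reals all_analysis.
Import Order.TTheory GRing.Theory Num.Theory numFieldNormedType.Exports.

Set Implicit Arguments.
Unset Strict Implicit.
Unset Printing Implicit Defensive.

Local Open Scope classical_set_scope.
Local Open Scope ring_scope.

(* Right derivative at 0, ordinary derivative at t > 0: the values of [f] and
   [df] on the negative half-line are irrelevant. *)
Definition derivative_on_halfline (R : realType) (V : normedModType R)
    (f df : R -> V) : Prop :=
  (forall t : R, 0 < t -> is_derive t 1 f (df t)) /\
  h^-1 *: (f h - f 0) @[h --> 0^'+] --> df 0.

Section HilbertSpace.
Variables (R : realType) (H : completeNormedModType R).
Variable ip : {dot H for idfun}.

(* [ip] is a symmetric positive definite bilinear form; this makes the complete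
   normed space [H] a real Hilbert space with scalar product [ip]. *)
Definition norm_compatible : Prop := forall x : H, ip x x = `|x| ^+ 2.

Definition orthonormal_basis (e : nat -> H) : Prop :=
  (forall i j, ip (e i) (e j) = (i == j)%:R) /\
  dense [set x | exists n (c : nat -> R), x = \sum_(k < n) c k *: e k].

(* A possibly unbounded operator is a pair [(D, A)]; the values of [A] outside
   its domain [D] are irrelevant. *)
Definition linear_operator (D : set H) (A : H -> H) : Prop :=
  D 0 /\ forall (a : R) x y, D x -> D y ->
    D (a *: x + y) /\ A (a *: x + y) = a *: A x + A y.

(* The left-hand side says that [(y, z)] is in the graph of the adjoint. *)
Definition self_adjoint (D : set H) (A : H -> H) : Prop :=
  forall y z, (forall x, D x -> ip (A x) y = ip x z) <-> (D y /\ A y = z).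

Section SquareRoot.
Variables (e : nat -> H) (lambda : nat -> R).

(* The operator A^{1/2}, where A e_k = lambda_k^2 e_k. *)
Definition sqrt_dom : set H :=
  [set x | cvgn (series (fun k => lambda k ^+ 2 * ip x (e k) ^+ 2))].

Definition sqrt_op (x : H) : H :=
  limn (series (fun k => (lambda k * ip x (e k)) *: e k)).

(* u in C^1([0,+oo), H) with derivative [du], and u in C^0([0,+oo), D(A^{1/2})),
   the latter for the graph norm, hence the continuity of both u and A^{1/2} u
   (the continuity of u follows from its differentiability).
   The equation is tested against all v in D(A), with
   <A^{1/2} u, A^{1/2} v> written as <u, A v>. *)
Record weak_solution (D : set H) (A : H -> H) (u0 u1 : H) (u du : R -> H) :
    Prop := WeakSolution {
  weak_sol_deriv : derivative_on_halfline u du ;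
  weak_sol_deriv_cont : {within `[0, +oo[, continuous du} ;
  weak_sol_dom : forall t : R, 0 <= t -> sqrt_dom (u t) ;
  weak_sol_sqrt_cont : {within `[0, +oo[, continuous (sqrt_op \o u)} ;
  weak_sol_eq : forall v, D v ->
    derivative_on_halfline (fun t => ip (du t) v : R^o)
      (fun t => - (`|du t| ^+ 2 * ip (du t) v + ip (u t) (A v))) ;
  weak_sol_init0 : u 0 = u0 ;
  weak_sol_init1 : du 0 = u1
}.

Definition energy (u du : R -> H) (t : R) : R :=
  `|du t| ^+ 2 + `|sqrt_op (u t)| ^+ 2.

(* The scalar product of the Hilbert space D(A^{1/2}) x H, the first factor
   being endowed with the graph norm of A^{1/2}. *)
Definition phase_ip (z w : H * H) : R :=
  ip z.1 w.1 + ip (sqrt_op z.1) (sqrt_op w.1) + ip z.2 w.2.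

Definition phase_norm (z : H * H) : R := Num.sqrt (phase_ip z z).

Definition phase_weak_cvg (z : R -> H * H) (l : H * H) : Prop :=
  forall w : H * H, sqrt_dom w.1 ->
    phase_ip (z t) w @[t --> +oo] --> phase_ip l w.

Definition phase_strong_cvg (z : R -> H * H) (l : H * H) : Prop :=
  phase_norm (z t - l) @[t --> +oo] --> (0 : R).

End SquareRoot.

Definition active_modes (e : nat -> H) (u0 u1 : H) : set nat :=
  [set k | ip u1 (e k) ^+ 2 + ip u0 (e k) ^+ 2 != 0].

End HilbertSpace.

(* Main.v *)
Require Import Defs.
From HB Require Import structures.
From mathcomp Require Import all_boot all_order all_algebra.
From mathcomp Require Import all_classical all_reals all_analysis.
From mathcomp Require Import ring lra.
Import Order.TTheory GRing.Theory Num.Theory numFieldNormedType.Exports.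

Set Implicit Arguments.
Unset Strict Implicit.
Unset Printing Implicit Defensive.

Local Open Scope classical_set_scope.
Local Open Scope ring_scope.

(** Expanding the solution in the basis e_k turns the equation into a system of
    oscillators u_k'' + g u_k' + lambda_k^2 u_k = 0, coupled only through the
    common damping coefficient g = |u'|^2. Write e_k = u_k'^2 + lambda_k^2 u_k^2
    for the energy of the mode k and theta_k for its phase, so that
    lambda_k u_k = sqrt(e_k) cos(theta_k) and u_k' = - sqrt(e_k) sin(theta_k); a mode is
    active when e_k does not vanish initially, and then e_k never vanishes
    (mode_energy_stays_positive), whereas the other modes remain at rest.

    The total energy E satisfies E' = - 2 g^2. Adding to it a small multiple of
    E <u,u'> gives a function W, comparable with E, such that W' <= - c E^2
    (corrected_energy). Hence t E is bounded above, E^2 is integrable, and since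
    g <= E, also t E is bounded below.

    The core of the proof is an averaging argument. From
    (ln e_k)' = - 2 g sin^2(theta_k) = - g + g cos(2 theta_k) and
    g = sum_i e_i sin^2(theta_i), the only contribution to g cos(2 theta_k) which
    does not oscillate comes from i = k and equals - e_k / 4. The remaining terms have
    frequencies bounded away from 0, because the lambda_i are strictly
    increasing, and are integrated by parts at the cost of errors of order
    E^2, summable over i and integrable over t (oscillating_damping_cvg). Therefore

      ln e_k + G + X_k / 4  converges,  where G' = g and X_k' = e_k

    (log_energy_cvg). This relation can be integrated explicitly. If
    M' = exp(- G), it says that (exp(X_k / 4))' is asymptotic to a constant
    multiple of M'. If M is unbounded, then e_k is asymptotic to 4 M' / M, which is
    the same function for all the active modes (mode_profile), and the primitive of
    u_k'^2 is 2 ln M + const + o(1) because kinetic energy is on average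
    half of the energy (kinetic_half_cvg).

    If there are j active modes, adding these primitives gives
    G = 2 j ln M + const + o(1). So M^(2j) M' has a positive limit, t M' / M
    tends to 1 / (2j + 1), and t e_k tends to 4 / (2j + 1)
    (finite_modes_rate). The same averaging applied to g sin(2 theta_k) shows that
    theta_k - lambda_k t converges, which yields the asymptotic profile
    (polar_asymptotics). If there are infinitely many active modes, then for every n
    the function M^(2n) M' is eventually almost nonincreasing, which bounds the
    upper limit of t M' / M by a multiple of 1 / n, and so t e_k tends to 0
    (infinite_modes_rate). Since t E remains bounded above and below, the rescaled
    solution converges weakly but not strongly. *)

(** * Calculus on the half-line *)

(** The modes are differentiable on the open half-line only; the initial
    instant is handled by right limits. *)
Definition has_deriv {R : realType} (f df : R -> R) : Prop :=
  forall t : R, 0 < t -> is_derive t (1 : R) f (df t).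

Section PointwiseDerivatives.
Context {R : realType}.
Implicit Types (f g : R -> R) (t : R).

Lemma is_derive_fcst t (c : R) : is_derive t (1 : R) (fun=> c) (0 : R).
Proof. exact: is_derive_cst. Qed.

Lemma is_derive_fid t : is_derive t (1 : R) (fun x : R => x) (1 : R).
Proof. exact: is_derive_id. Qed.

Lemma is_derive_fD f g t (df dg : R) : is_derive t (1 : R) f df ->
  is_derive t (1 : R) g dg -> is_derive t (1 : R) (fun x => f x + g x) (df + dg).
Proof. by move=> ? ?; exact: is_deriveD. Qed.

Lemma is_derive_fN f t (df : R) : is_derive t (1 : R) f df ->
  is_derive t (1 : R) (fun x => - f x) (- df).
Proof. by move=> ?; exact: is_deriveN. Qed.

Lemma is_derive_fM f g t (df dg : R) : is_derive t (1 : R) f df ->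
  is_derive t (1 : R) g dg ->
  is_derive t (1 : R) (fun x => f x * g x) (f t * dg + g t * df).
Proof. by move=> ? ?; exact: is_deriveM. Qed.

Lemma is_derive_fX f n t (df : R) : is_derive t (1 : R) f df ->
  is_derive t (1 : R) (fun x => f x ^+ n) (n%:R * f t ^+ n.-1 * df).
Proof.
move=> ?; have -> : (fun x => f x ^+ n) = f ^+ n.
  by apply/funext => x; elim: n => [|n IH]; rewrite ?expr0// !exprS IH.
exact: is_deriveX.
Qed.

Lemma is_derive_fV f t (df : R) : f t != 0 -> is_derive t (1 : R) f df ->
  is_derive t (1 : R) (fun x => (f x)^-1) (- (f t) ^- 2 * df).
Proof. by move=> ? ?; exact: is_deriveV. Qed.

Lemma is_derive_fexp f t (df : R) : is_derive t (1 : R) f df ->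
  is_derive t (1 : R) (fun x => expR (f x)) (expR (f t) * df).
Proof. by move=> ?; exact: (@is_derive1_comp _ expR f). Qed.

Lemma is_derive_fln f t (df : R) : 0 < f t -> is_derive t (1 : R) f df ->
  is_derive t (1 : R) (fun x => ln (f x)) ((f t)^-1 * df).
Proof.
move=> f0 ?; apply: (@is_derive1_comp _ (@ln R) f).
exact: is_derive1_ln.
Qed.

Lemma is_derive_fcos f t (df : R) : is_derive t (1 : R) f df ->
  is_derive t (1 : R) (fun x => cos (f x)) (- sin (f t) * df).
Proof. by move=> ?; exact: (@is_derive1_comp _ cos f). Qed.

Lemma is_derive_fsin f t (df : R) : is_derive t (1 : R) f df ->
  is_derive t (1 : R) (fun x => sin (f x)) (cos (f t) * df).
Proof. by move=> ?; exact: (@is_derive1_comp _ sin f). Qed.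

Lemma is_derive_fsum (F dF : nat -> R -> R) n t :
  (forall i, (i < n)%N -> is_derive t (1 : R) (F i) (dF i t)) ->
  is_derive t (1 : R) (fun x => \sum_(i < n) F i x) (\sum_(i < n) dF i t).
Proof.
move=> H; have -> : (fun x => \sum_(i < n) F i x) = \sum_(i < n) F i.
  by apply/funext => x; rewrite fct_sumE.
by apply: is_derive_sum => i; exact: H.
Qed.

End PointwiseDerivatives.

(** Differentiates an arithmetic expression structurally, using the hypotheses
    of the form [is_derive] or [has_deriv] at the leaves. The derivative may be
    an existential variable; nonvanishing conditions are left to the user. *)
Ltac differentiate :=
  lazymatch goal with
  | |- is_derive _ _ (fun _ => ?c) _ => exact: is_derive_fcst
  | |- is_derive _ _ (fun x => x) _ => exact: is_derive_fid
  | |- is_derive _ _ (fun x => @?f x + @?g x) _ =>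
      eapply (@is_derive_fD _ f g); differentiate
  | |- is_derive _ _ (fun x => - @?f x) _ =>
      eapply (@is_derive_fN _ f); differentiate
  | |- is_derive _ _ (fun x => @?f x * @?g x) _ =>
      eapply (@is_derive_fM _ f g); differentiate
  | |- is_derive _ _ (fun x => @?f x ^+ ?n) _ =>
      eapply (@is_derive_fX _ f n); differentiate
  | |- is_derive _ _ (fun x => (@?f x)^-1) _ =>
      eapply (@is_derive_fV _ f); [ | differentiate]
  | |- is_derive _ _ (fun x => expR (@?f x)) _ =>
      eapply (@is_derive_fexp _ f); differentiate
  | |- is_derive _ _ (fun x => ln (@?f x)) _ =>
      eapply (@is_derive_fln _ f); [ | differentiate]
  | |- is_derive _ _ (fun x => cos (@?f x)) _ =>
      eapply (@is_derive_fcos _ f); differentiate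
  | |- is_derive _ _ (fun x => sin (@?f x)) _ =>
      eapply (@is_derive_fsin _ f); differentiate
  | H : has_deriv ?f _ |- is_derive _ _ ?f _ => eapply H; first [eassumption|idtac]
  | H : has_deriv ?f _ |- is_derive _ _ (fun x => ?f x) _ => eapply H; first [eassumption|idtac]
  | H : forall i, has_deriv (?f i) _ |- is_derive _ _ (?f _) _ => eapply H; first [eassumption|idtac]
  | H : forall i, has_deriv (?f i) _ |- is_derive _ _ (fun x => ?f _ x) _ => eapply H; first [eassumption|idtac]
  | |- _ => first [eassumption | idtac]
  end.

(** Reduces [is_derive t 1 f d] to an equation between [d] and the derivative
    computed structurally. Type class resolution is bypassed since it would
    close the first goal with a derivative in another form. *)
Ltac derive_as := notypeclasses refine (@is_derive_eq _ _ _ _ _ _ _ _ _ _);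
  [differentiate | ].

Section HalfLine.
Context {R : realType}.
Implicit Types (f g h df dg dh : R -> R) (s t : R).

Lemma has_deriv_continuous f df t : has_deriv f df -> 0 < t -> {for t, continuous f}.
Proof.
move=> fd t0; have [fdt _] := fd _ t0.
by apply: differentiable_continuous; exact/derivable1_diffP.
Qed.

Lemma MVT_on_segment f df s t :
  (forall x, s <= x <= t -> is_derive x (1 : R) f (df x)) -> s <= t ->
  exists2 c, s <= c <= t & f t - f s = df c * (t - s).
Proof.
move=> fd st; have [||c] := @MVT_segment R f df s t st.
- by move=> x /[!in_itv]/= /andP[sx xt]; apply: fd; rewrite !ltW.
- apply: continuous_in_subspaceT => x /[!inE]/= /[!in_itv]/= /fd[fdx _].
  by apply: differentiable_continuous; exact/derivable1_diffP.
- by rewrite in_itv /= => sct ->; exists c.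
Qed.

Lemma has_deriv_MVT f df s t : has_deriv f df -> 0 < s -> s <= t ->
  exists2 c, s <= c <= t & f t - f s = df c * (t - s).
Proof.
move=> fd s0; apply: MVT_on_segment => x /andP[sx _].
by apply: fd; exact: lt_le_trans sx.
Qed.

Lemma deriv_ge0_nondecreasing f df s t : has_deriv f df ->
  (forall x, s <= x <= t -> 0 <= df x) -> 0 < s -> s <= t -> f s <= f t.
Proof.
move=> fd df0 s0 st; have [c cst E] := has_deriv_MVT fd s0 st.
by rewrite -subr_ge0 E mulr_ge0 ?df0// subr_ge0.
Qed.

Lemma deriv_le0_nonincreasing f df s t : has_deriv f df ->
  (forall x, s <= x <= t -> df x <= 0) -> 0 < s -> s <= t -> f t <= f s.
Proof.
move=> fd df0 s0 st; have [c cst E] := has_deriv_MVT fd s0 st.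
by rewrite -subr_le0 E mulr_le0_ge0 ?df0// subr_ge0.
Qed.

Lemma increment_le f df h dh s t : has_deriv f df -> has_deriv h dh ->
  (forall x, s <= x <= t -> df x <= dh x) -> 0 < s -> s <= t ->
  f t - f s <= h t - h s.
Proof.
move=> fd hd dfh s0 st.
have hfd : has_deriv (fun x => h x - f x) (fun x => dh x - df x).
  by move=> x x0; differentiate.
suff H x : s <= x <= t -> 0 <= dh x - df x.
  by have := deriv_ge0_nondecreasing hfd H s0 st; lra.
by move=> /dfh; lra.
Qed.

Lemma increment_norm_le f df h dh s t : has_deriv f df -> has_deriv h dh ->
  (forall x, s <= x <= t -> `|df x| <= dh x) -> 0 < s -> s <= t ->
  `|f t - f s| <= h t - h s.
Proof.
move=> fd hd dfh s0 st; rewrite ler_norml; apply/andP; split; last first.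
  by apply: increment_le fd hd _ s0 st => x /dfh; rewrite ler_norml => /andP[].
have nfd : has_deriv (fun x => - f x) (fun x => - df x).
  by move=> x x0; differentiate.
suff H x : s <= x <= t -> - df x <= dh x.
  by have := increment_le nfd hd H s0 st; lra.
by move=> /dfh; rewrite ler_norml => /andP[]; lra.
Qed.

Lemma deriv0_constant f df s t : has_deriv f df ->
  (forall x, s <= x <= t -> df x = 0) -> 0 < s -> s <= t -> f t = f s.
Proof.
move=> fd df0 s0 st; have [c cst E] := has_deriv_MVT fd s0 st.
by apply/eqP; rewrite -subr_eq0 E df0// mul0r.
Qed.

End HalfLine.

Section Primitives.
Context {R : realType}.
Implicit Types (f F : R -> R) (s t x : R).

Lemma primitive_above f (a : R) : (forall t, 0 < t -> {for t, continuous f}) ->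
  0 < a -> exists F : R -> R, forall x, a < x -> is_derive x (1 : R) F (f x).
Proof.
move=> cf a0.
exists (fun x => \int[lebesgue_measure]_(t in `[a, x]) f t)%R => x ax.
have fi : lebesgue_measure.-integrable `[a, x + 1] (EFin \o f).
  apply: continuous_compact_integrable; first exact: segment_compact.
  apply: continuous_in_subspaceT => y /[!inE]/= /[!in_itv]/= /andP[ay _].
  by apply: cf; exact: lt_le_trans ay.
have [|||dF vF] := @continuous_FTC1_closed R f a x (x + 1) _ fi.
- by rewrite ltrDl.
- exact: ax.
- by apply: cf; exact: lt_trans ax.
by split => //; rewrite -derive1E vF.
Qed.

(** The Lebesgue integral from a > 0 gives a primitive above a; these primitives
    agree up to constants and can be glued as a tends to 0. *)
Lemma primitive_exists f : (forall t, 0 < t -> {for t, continuous f}) ->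
  exists F : R -> R, has_deriv F f.
Proof.
move=> cf.
have /choice[P HP] : forall a : R, exists F : R -> R, 0 < a ->
    forall x, a < x -> is_derive x (1 : R) F (f x).
  move=> a; have [a0|a0] := ltP 0 a; last by exists (cst 0).
  by have [F HF] := primitive_above cf a0; exists F.
(* [F] is the primitive vanishing at 1; near [x] it is given by the primitive
   based at any point below both [x] and 1 *)
pose low x := Num.min x 1 / 2.
have low0 x : 0 < x -> 0 < low x by move=> x0; rewrite divr_gt0// lt_min x0/=.
have lowx x : 0 < x -> low x < x.
  move=> x0; rewrite ltr_pdivrMr//; have : Num.min x 1 <= x by rewrite ge_min lexx.
  by lra.
have low1 x : low x < 1.
  rewrite ltr_pdivrMr//; have : Num.min x 1 <= 1 by rewrite ge_min lexx orbT.
  by lra.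
pose F x := P (low x) x - P (low x) 1.
have indep (a b x : R) : 0 < a -> 0 < b -> a < x -> b < x -> a < 1 -> b < 1 ->
    P a x - P a 1 = P b x - P b 1.
  move=> a0 b0 ax bx a1 b1; set m := Num.max a b.
  pose D y := P a (y + m) - P b (y + m).
  have m0 : 0 < m by rewrite lt_max a0.
  have hD : has_deriv D (fun=> 0).
    have sh G (c : R) t : is_derive (t + m) (1 : R) G c ->
        is_derive t (1 : R) (fun y => G (y + m)) c.
      move=> HG; have -> : c = c * 1 by rewrite mulr1.
      apply: (@is_derive1_comp _ G (fun y => y + m)) => //.
      by derive_as; rewrite addr0.
    move=> t t0; rewrite -(subrr (f (t + m))).
    have am : a <= m by rewrite le_max lexx.
    have bm : b <= m by rewrite le_max lexx orbT.
    by apply: is_derive_fD; [|apply: is_derive_fN]; apply: sh; apply: HP => //; lra.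
  have xm : m < x by rewrite gt_max ax bx.
  have ym : m < 1 by rewrite gt_max a1 b1.
  have E : D (x - m) = D (1 - m).
    have [le|/ltW le] := leP (x - m) (1 - m).
      by rewrite (deriv0_constant hD _ _ le)//; lra.
    by rewrite -(deriv0_constant hD _ _ le)//; lra.
  by move: E; rewrite /D !subrK; lra.
exists F => x x0.
apply: (@near_eq_is_derive _ _ _ (fun y => P (low x) y - P (low x) 1)).
  near=> y.
  have y0 : 0 < y by near: y; exact: lt_nbhsr.
  have xy : low x < y by near: y; apply: lt_nbhsr; exact: lowx.
  by rewrite /F; apply: indep; rewrite ?low0 ?lowx ?low1.
rewrite -[f x]subr0; apply: is_derive_fD; first by apply: HP; [exact: low0|exact: lowx].
Unshelve. all: by end_near. Qed.

End Primitives.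

Section TermwiseDifferentiation.
Context {R : realType}.
Implicit Types (f F : R -> R) (s t x : R).

Lemma MVT_two_sided f df s t : has_deriv f df -> 0 < s -> 0 < t ->
  exists2 c, `|c - t| <= `|s - t| /\ 0 < c & f s - f t = df c * (s - t).
Proof.
move=> fd s0 t0; have [st|/ltW ts] := leP s t.
  have [c /andP[sc ct] E] := has_deriv_MVT fd s0 st.
  exists c; last by lra.
  by rewrite distrC (distrC s) !ger0_norm; lra.
have [c /andP[sc ct] E] := has_deriv_MVT fd t0 ts.
exists c; last by lra.
by rewrite !ger0_norm; lra.
Qed.

Lemma is_derive_from_increment f t (l : R) :
  (forall e : R, 0 < e -> \forall s \near t, `|f s - f t - l * (s - t)| <= e * `|s - t|) ->
  is_derive t (1 : R) f l.
Proof.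
move=> H.
suff C : (fun h => h^-1 *: ((f \o shift t) (h *: (1 : R)) - f t)) @ 0^' --> (l : R).
  by split; [exact: (cvgP l)|exact: (cvg_lim _ C)].
apply/cvgrPdist_le => e e0.
have {}H : \forall h \near (0 : R), `|f (h + t) - f t - l * h| <= e * `|h|.
  move: (H e e0); rewrite (near_shift 0 t); apply: filterS => h /=.
  by rewrite subr0 addrK.
near=> h.
have h0 : h != 0 by near: h; exact: nbhs_dnbhs_neq.
have Hh : `|f (h + t) - f t - l * h| <= e * `|h|.
  by near: h; apply: nbhs_dnbhs.
rewrite /= [h *: 1]mulr1 distrC.
rewrite -[l](mulfK h0) mulrC -mulrBr.
by rewrite normrM normfV ler_pdivrMl ?normr_gt0// mulrC (mulrC h) (mulrC `|h|).
Unshelve. all: by end_near. Qed.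

(** Dini's argument: the error bounds [T n] are continuous and decrease to 0, so
    that smallness of [T n] at [t] for one [n] persists near [t] and for all larger
    indices. The mean value theorem then gives the derivative of the limit. *)
Lemma termwise_derivative (F f T : nat -> R -> R) (Fl fl : R -> R) :
  (forall n, has_deriv (F n) (f n)) ->
  (forall t, 0 < t -> F n t @[n --> \oo] --> Fl t) ->
  (forall n t, 0 < t -> `|f n t - fl t| <= T n t) ->
  (forall m n t, 0 < t -> (m <= n)%N -> T n t <= T m t) ->
  (forall t, 0 < t -> T n t @[n --> \oo] --> 0) ->
  (forall n t, 0 < t -> {for t, continuous (T n)}) ->
  (forall t, 0 < t -> {for t, continuous fl}) ->
  has_deriv Fl fl.
Proof.
move=> dF cF fT Tmono T0 Tc flc t t0.
apply: is_derive_from_increment => e e0.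
have e2 : 0 < e / 2 by lra.
have [n _ Tn] : \forall n \near \oo, T n t < e / 2.
  exact: (cvgr_lt (0 : R) (T0 _ t0)).
have {}Tn : T n t < e / 2 by apply: Tn => /=.
have near_t : \forall s \near t, [/\ 0 < s, T n s <= e / 2 & `|fl s - fl t| <= e / 2].
  near=> s; split.
  - by near: s; exact: lt_nbhsr.
  - by apply: ltW; near: s; exact: (cvgr_lt _ (Tc n _ t0)).
  - rewrite distrC; near: s; move: e2; move: (e / 2).
    exact/(@cvgrPdist_le _ _ _ _ _ fl)/flc.
have /nbhs_ballP[d d0 ball_t] := near_t.
near=> s.
have st : `|s - t| < d by rewrite distrC; near: s; exact: cvgr_dist_lt.
have s0 : 0 < s by near: s; exact: lt_nbhsr.
have incr m : (n <= m)%N -> `|F m s - F m t - fl t * (s - t)| <= e * `|s - t|.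
  move=> nm; have [c [ct c0] ->] := MVT_two_sided (dF m) s0 t0.
  rewrite -mulrBl normrM ler_wpM2r//.
  have [_ Tc2 flc2] : [/\ 0 < c, T n c <= e / 2 & `|fl c - fl t| <= e / 2].
    by apply: ball_t; rewrite /ball /= distrC; exact: le_lt_trans ct st.
  have := fT m _ c0; have := Tmono _ _ _ c0 nm.
  have := ler_normD (f m c - fl c) (fl c - fl t).
  have -> : f m c - fl c + (fl c - fl t) = f m c - fl t by ring.
  by lra.
have lim_incr : `|F m s - F m t - fl t * (s - t)| @[m --> \oo] -->
    `|Fl s - Fl t - fl t * (s - t)|.
  apply: cvg_norm; apply: cvgB; last exact: cvg_cst.
  by apply: cvgB; exact: cF.
apply: (cvgr_to_le lim_incr).
by exists n => // m /= nm; exact: incr.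
Unshelve. all: by end_near. Qed.

End TermwiseDifferentiation.

(** * Limits at infinity *)

Section LimitsAtInfinity.
Context {R : realType}.
Implicit Types (f F L M Q : R -> R) (s t x : R).

Lemma nondecreasing_bounded_cvg Q (B : R) :
  (forall s t, 1 <= s -> s <= t -> Q s <= Q t) ->
  (forall t, 1 <= t -> Q t <= B) ->
  exists q : R, Q t @[t --> +oo] --> q /\ forall t, 1 <= t -> Q t <= q.
Proof.
move=> Qm QB; pose P t := Q (Num.max 1 t).
have max1 t : 1 <= Num.max 1 t by rewrite le_max lexx.
have maxE t : 1 <= t -> Num.max 1 t = t by move/max_idPr.
have Pm : {homo P : s t / s <= t}.
  move=> s t st; apply: Qm => //.
  by rewrite ge_max !le_max lexx st orbT.
have Pub : has_ubound (range P) by exists B => _ [t _ <-]; exact: QB.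
have cP := nondecreasing_cvgr Pm Pub.
have PQ : \forall t \near +oo, P t = Q t.
  by near=> t; rewrite /P maxE//; near: t; apply: nbhs_pinfty_ge; exact: num_real.
exists (sup (range P)); split.
  by apply: cvg_trans cP; apply: near_eq_cvg.
move=> t t1; rewrite -(maxE _ t1); apply: sup_upper_bound.
  by split=> //; exists (P 0), 0.
by exists t.
Unshelve. all: by end_near. Qed.

Lemma nondecreasing_dichotomy M :
  (forall s t, 1 <= s -> s <= t -> M s <= M t) ->
  (M t @[t --> +oo] --> +oo) \/ exists B : R, forall t, 1 <= t -> M t <= B.
Proof.
move=> Mm; have [[B HB]|nB] := pselect (exists B : R, forall t, 1 <= t -> M t <= B).
  by right; exists B.
left; apply/cvgryPge => A.
have [t [t1 At]] : exists t, 1 <= t /\ A <= M t.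
  apply: contrapT => nA; apply: nB; exists A => t t1.
  by rewrite leNgt; apply/negP => /ltW At; apply: nA; exists t.
by near=> s; apply: le_trans At _; apply: Mm.
Unshelve. all: by end_near. Qed.

Lemma cvg_of_increments L (h Q : R -> R) (q : R) :
  (forall s t, 1 <= s -> s <= t -> `|L t - L s| <= h t + h s + (Q t - Q s)) ->
  h t @[t --> +oo] --> 0 -> Q t @[t --> +oo] --> q ->
  exists l : R, L t @[t --> +oo] --> l.
Proof.
move=> HL h0 Qq; suff : cvg (L t @[t --> +oo]) by move=> /cvg_ex[l Hl]; exists l.
apply/cauchy_cvgP; apply: cauchy_exP => e e0.
have e8 : 0 < e / 8 by lra.
have small : \forall s \near +oo, [/\ 1 <= s, `|h s| <= e / 8 & `|q - Q s| <= e / 8].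
  near=> s; split; near: s; first exact: nbhs_pinfty_ge.
    by have /cvgrPdist_le/(_ _ e8) := h0; apply: filterS => s; rewrite sub0r normrN.
  by have /cvgrPdist_le/(_ _ e8) := Qq.
have [s0 [_ Hs0]] := small.
have [s1 h1 Q1] := Hs0 (s0 + 1) ltac:(rewrite ltrDl//).
exists (L (s0 + 1)).
suff : \forall t \near +oo, ball (L (s0 + 1)) e (L t) by [].
near=> t; rewrite /ball /=.
have [t1 ht Qt] : [/\ 1 <= t, `|h t| <= e / 8 & `|q - Q t| <= e / 8].
  by near: t; exact: small.
have st : s0 + 1 <= t by near: t; apply: nbhs_pinfty_ge; exact: num_real.
rewrite distrC; apply: le_lt_trans (HL _ _ s1 st) _.
by move: h1 Q1 ht Qt; rewrite !ler_norml => /andP[? ?] /andP[? ?] /andP[? ?] /andP[? ?]; lra.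
Unshelve. all: by end_near. Qed.

(** L'Hospital's rule at infinity, in the form in which the quotient of the
    derivatives is given as [phi], so that [m] may vanish. *)
Lemma cvg_quotient_of_derivatives F (f phi M m : R -> R) (l : R) :
  has_deriv F f -> has_deriv M m -> (forall t, 0 < t -> 0 <= m t) ->
  (forall t, 0 < t -> f t = phi t * m t) ->
  phi t @[t --> +oo] --> l -> M t @[t --> +oo] --> +oo ->
  F t / M t @[t --> +oo] --> l.
Proof.
move=> dF dM m0 fE philim Mlim; apply/cvgrPdist_le => e e0.
have e2 : 0 < e / 2 by lra.
have [T0 [_ HT0]] : \forall s \near +oo, `|l - phi s| <= e / 2.
  by have /cvgrPdist_le/(_ _ e2) := philim.
pose T := Num.max T0 0 + 1.
have T_gt0 : 0 < T by rewrite ltr_wpDl// le_max lexx orbT.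
have T0T : T0 < T by rewrite (@le_lt_trans _ _ (Num.max T0 0))// ?ltrDl// le_max lexx.
pose K := `|F T - l * M T| + e / 2 * `|M T|.
near=> t.
have Tt : T <= t by near: t; apply: nbhs_pinfty_ge; exact: num_real.
have Mt1 : 1 <= M t by near: t; have /cvgryPge := Mlim; exact.
have MtK : K * 2 / e <= M t by near: t; have /cvgryPge := Mlim; exact.
have dG : has_deriv (fun t => F t - l * M t) (fun t => f t - l * m t).
  by move=> x x0; derive_as; ring.
have deM : has_deriv (fun t => e / 2 * M t) (fun t => e / 2 * m t).
  by move=> x x0; derive_as; ring.
have incr : `|F t - l * M t - (F T - l * M T)| <= e / 2 * M t - e / 2 * M T.
  apply: (increment_norm_le dG deM) => // x /andP[Tx _].
  have x0 : 0 < x by exact: lt_le_trans Tx.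
  rewrite fE// -mulrBl normrM (ger0_norm (m0 _ x0)) ler_wpM2r ?m0//.
  by rewrite distrC; apply: HT0; exact: lt_le_trans Tx.
have Mt0 : 0 < M t by lra.
have -> : l - F t / M t = - (F t - l * M t) / M t by field; rewrite gt_eqF.
rewrite normrM normrN normfV (gtr0_norm Mt0) ler_pdivrMr//.
have := ler_normD (F t - l * M t - (F T - l * M T)) (F T - l * M T).
rewrite subrK.
have : K <= e / 2 * M t by move: MtK; rewrite ler_pdivrMr//; lra.
have : e / 2 * - M T <= e / 2 * `|M T| by rewrite ler_pM2l// -normrN ler_norm.
by rewrite /K; lra.
Unshelve. all: by end_near. Qed.

Lemma norm_mul_le (x y A B : R) : `|x| <= A -> `|y| <= B -> `|x * y| <= A * B.
Proof. by move=> xA yB; rewrite normrM ler_pM. Qed.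

Lemma cvg_inv_infty : (t^-1 : R) @[t --> +oo] --> (0 : R).
Proof.
apply/cvgrPdist_le => e e0; near=> t.
have t0 : 0 < t by near: t; exact: nbhs_pinfty_gt.
by rewrite sub0r normrN gtr0_norm ?invr_gt0// -[e]invrK lef_pV2 ?posrE ?invr_gt0.
Unshelve. all: by end_near. Qed.

Lemma cvg_ln (f : R -> R) (l : R) : 0 < l -> f t @[t --> +oo] --> l ->
  ln (f t) @[t --> +oo] --> ln l.
Proof. by move=> l0 fl; apply: continuous_cvg fl; exact: continuous_ln. Qed.

Lemma cvg_expR (f : R -> R) (l : R) : f t @[t --> +oo] --> l ->
  expR (f t) @[t --> +oo] --> expR l.
Proof. by move=> fl; apply: continuous_cvg fl; exact: continuous_expR. Qed.

Lemma cvg0_mul_bounded (f h : R -> R) : f t @[t --> +oo] --> (0 : R) ->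
  (forall t, `|h t| <= 1) -> f t * h t @[t --> +oo] --> (0 : R).
Proof.
move=> /cvgrPdist_le f0 h1; apply/cvgrPdist_le => eps eps0.
near=> t; have ft : `|f t| <= eps.
  by rewrite -normrN -[- f t]add0r; near: t; exact: f0.
by rewrite sub0r normrN normrM (le_trans _ ft)// ler_piMr.
Unshelve. all: by end_near. Qed.

Lemma cvg0_of_sqr_le (f h : R -> R) : (\forall t \near +oo, f t ^+ 2 <= h t) ->
  h t @[t --> +oo] --> (0 : R) -> f t @[t --> +oo] --> (0 : R).
Proof.
move=> fh /cvgrPdist_le h0; apply/cvgrPdist_le => eps eps0.
have eps2 : 0 < eps ^+ 2 by rewrite exprn_gt0.
near=> t; rewrite sub0r normrN -(ler_sqr (normr_ge0 _) (ltW eps0)) real_normK ?num_real//.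
have ht : `|0 - h t| <= eps ^+ 2 by near: t; exact: h0.
have ft : f t ^+ 2 <= h t by near: t.
by rewrite (le_trans ft)// (le_trans (ler_norm _))// -normrN -sub0r.
Unshelve. all: by end_near. Qed.

Lemma cvg_sum (n : nat) (f : nat -> R -> R) :
  (forall i, (i < n)%N -> exists l : R, f i t @[t --> +oo] --> l) ->
  exists l : R, \sum_(i < n) f i t @[t --> +oo] --> l.
Proof.
elim: n => [|n IH] H.
  by exists 0; under eq_fun do rewrite big_ord0; exact: cvg_cst.
have [|l Hl] := IH; first by move=> i ni; apply: H; rewrite ltnS ltnW.
have [l' Hl'] := H n (ltnSn n).
by exists (l + l'); under eq_fun do rewrite big_ord_recr /=; exact: cvgD.
Qed.

Lemma limf_einf_gt0 (f : R -> R) (c : R) : 0 < c -> (forall t, 1 <= t -> c <= f t) ->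
  (0 < limf_einf (fun t => (f t)%:E) +oo%R)%E.
Proof.
move=> c0 cf; apply: (@lt_le_trans _ _ c%:E); first by rewrite lte_fin.
rewrite limf_einfE; apply: (@le_trans _ _ (ereal_inf [set (f t)%:E | t in [set t | 1 <= t]])).
  by apply/ereal_infP => _ [t /= t1 <-]; rewrite lee_fin; exact: cf.
apply: ereal_sup_ubound; exists [set t | 1 <= t] => //=.
exact: nbhs_pinfty_ge.
Qed.

End LimitsAtInfinity.

Section PartialSums.
Context {R : realType}.

Lemma partial_sum_mono (u : nat -> R) m n : (forall i, 0 <= u i) -> (m <= n)%N ->
  \sum_(i < m) u i <= \sum_(i < n) u i.
Proof.
move=> u0 mn; rewrite -!(big_mkord xpredT u) (big_cat_nat (n := m) (p := n))//=.
by rewrite lerDl; apply: sumr_ge0.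
Qed.

Lemma partial_sum_le (u : nat -> R) (l : R) n : (forall i, 0 <= u i) ->
  \sum_(i < n) u i @[n --> \oo] --> l -> \sum_(i < n) u i <= l.
Proof.
move=> u0 ul; apply: (cvgr_to_ge ul); exists n => // m /= nm.
exact: partial_sum_mono.
Qed.

Lemma nonneg_sums_cvg (u : nat -> R) (B : R) : (forall i, 0 <= u i) ->
  (forall n, \sum_(i < n) u i <= B) -> cvg (\sum_(i < n) u i @[n --> \oo]).
Proof.
move=> u0 uB; apply: nondecreasing_is_cvgn.
  by move=> m n mn; exact: partial_sum_mono.
by exists B => _ [n _ <-].
Qed.

(** Absolute convergence, together with the control of the remainder which is
    needed for termwise differentiation. *)
Lemma dominated_partial_sums (u v : nat -> R) (l : R) :
  (forall i, `|u i| <= v i) -> \sum_(i < n) v i @[n --> \oo] --> l ->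
  exists s : R, \sum_(i < n) u i @[n --> \oo] --> s /\
    forall n, `|s - \sum_(i < n) u i| <= l - \sum_(i < n) v i.
Proof.
move=> uv vl.
have sE (w : nat -> R) : series w = (fun n => \sum_(i < n) w i).
  by apply/funext => n; rewrite /series /= big_mkord.
have v0 i : 0 <= v i by exact: le_trans (uv i).
have cv : cvgn (series v) by rewrite sE; apply/cvg_ex; exists l.
have cu : cvgn (series u).
  apply: normed_cvg; apply: series_le_cvg cv => // i; exact: normr_ge0.
move/cvg_ex: cu => [s]; rewrite sE => cs; exists s; split => // n.
have cl : `|\sum_(i < m) u i - \sum_(i < n) u i| @[m --> \oo] --> `|s - \sum_(i < n) u i|.
  by apply: cvg_norm; apply: cvgB => //; exact: cvg_cst.
apply: (cvgr_to_le cl); exists n => // m /= nm.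
have split_sum (w : nat -> R) :
    \sum_(i < m) w i - \sum_(i < n) w i = \sum_(n <= i < m) w i.
  rewrite -!(big_mkord xpredT w) (big_cat_nat (n := n) (p := m))//=.
  by rewrite addrAC subrr add0r.
rewrite split_sum; apply: (@le_trans _ _ (\sum_(i < m) v i - \sum_(i < n) v i)).
  rewrite split_sum; apply: le_trans (ler_norm_sum _ _ _) _.
  exact: ler_sum.
by rewrite lerB//; apply: partial_sum_le vl.
Qed.

Lemma sum_indicator (k n : nat) (z : R) : (k < n)%N ->
  \sum_(i < n) (nat_of_ord i == k)%:R * z = z.
Proof.
move=> kn; rewrite -mulr_suml (bigD1 (Ordinal kn))//= eqxx big1 ?addr0 ?mul1r// => i ik.
by rewrite (_ : (nat_of_ord i == k) = false)//; apply/negbTE.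
Qed.

Lemma stationary_sums_cvg (u : nat -> R) N : (forall i, (N <= i)%N -> u i = 0) ->
  \sum_(i < n) u i @[n --> \oo] --> \sum_(i < N) u i.
Proof.
move=> u0; apply: (@cvg_near_cst nat R); exists N => // n /= Nn.
rewrite -!(big_mkord xpredT u) (big_cat_nat (n := N) (p := n))//=.
rewrite [X in _ + X]big_nat_cond [X in _ + X]big1 ?addr0// => i /andP[/andP[Ni _] _].
exact: u0.
Qed.

End PartialSums.

(** * The energy of a damped system of modes *)

(** The modes in the normalization a_i = lambda_i u_i and b_i = u_i', in which
    the undamped motion is a rotation. *)
Record damped_modes {R : realType} (lam : nat -> R) (a b : nat -> R -> R)
    (g E : R -> R) : Prop := DampedModes {
  dm_pos : forall k, 0 < lam k ;
  dm_incr : forall k l, (k < l)%N -> lam k < lam l ;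
  dm_a : forall i, has_deriv (a i) (fun t => lam i * b i t) ;
  dm_b : forall i, has_deriv (b i) (fun t => - lam i * a i t - g t * b i t) ;
  dm_g : forall t, 0 < t -> \sum_(i < n) b i t ^+ 2 @[n --> \oo] --> g t ;
  dm_E : forall t, 0 < t ->
    \sum_(i < n) (a i t ^+ 2 + b i t ^+ 2) @[n --> \oo] --> E t ;
  dm_gc : forall t, 0 < t -> {for t, continuous g} ;
  dm_Ec : forall t, 0 < t -> {for t, continuous E} }.

Section Energy.
Context {R : realType} {lam : nat -> R} {a b : nat -> R -> R} {g E : R -> R}.
Context (S : damped_modes lam a b g E).

Local Notation en i t := (a i t ^+ 2 + b i t ^+ 2).
Local Notation EN n t := (\sum_(i < n) (a i t ^+ 2 + b i t ^+ 2)).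
Local Notation gN n t := (\sum_(i < n) b i t ^+ 2).

Lemma energy_mode_ge0 i t : 0 <= en i t.
Proof. by rewrite addr_ge0 ?sqr_ge0. Qed.

Lemma partial_energy_le n t : 0 < t -> EN n t <= E t.
Proof.
move=> t0; apply: (partial_sum_le (u := fun i => en i t)) (dm_E S t0) => i.
exact: energy_mode_ge0.
Qed.

Lemma partial_energy_mono m n t : (m <= n)%N -> EN m t <= EN n t.
Proof.
move=> mn; apply: (partial_sum_mono (u := fun i => en i t)) => // i.
exact: energy_mode_ge0.
Qed.

Lemma partial_damping_le n t : 0 < t -> gN n t <= g t.
Proof.
move=> t0; apply: (partial_sum_le (u := fun i => b i t ^+ 2)) (dm_g S t0) => i.
exact: sqr_ge0.
Qed.

Lemma damping_ge0 t : 0 < t -> 0 <= g t.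
Proof. by move=> t0; have := partial_damping_le 0 t0; rewrite big_ord0. Qed.

Lemma mode_energy_le i t : 0 < t -> en i t <= E t.
Proof.
move=> t0; apply: le_trans (partial_energy_le i.+1 t0).
by rewrite big_ord_recr /= lerDr; apply: sumr_ge0 => j _; exact: energy_mode_ge0.
Qed.

Lemma energy_ge0 t : 0 < t -> 0 <= E t.
Proof. by move=> t0; have := partial_energy_le 0 t0; rewrite big_ord0. Qed.

(** The remainder of g consists of the kinetic parts of the remainder of E. *)
Lemma damping_tail_le n t : 0 < t -> g t - gN n t <= E t - EN n t.
Proof.
move=> t0.
have c1 := cvgB (dm_E S t0) (dm_g S t0).
rewrite -subr_ge0 (_ : _ - _ = (E t - g t) - (EN n t - gN n t)); last by ring.
rewrite subr_ge0 -sumrB (eq_bigr (fun i : 'I_n => a i t ^+ 2)); last first.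
  by move=> i _; rewrite addrK.
apply: (partial_sum_le (u := fun i => a i t ^+ 2)) => [i|]; first exact: sqr_ge0.
suff -> : (fun m => \sum_(i < m) a i t ^+ 2) = (fun m => EN m t - gN m t) by exact: c1.
by apply/funext => m; rewrite -sumrB; apply: eq_bigr => i _; rewrite /= addrK.
Qed.

Lemma damping_le_energy t : 0 < t -> g t <= E t.
Proof. by move=> t0; have := damping_tail_le 0 t0; rewrite !big_ord0 !subr0. Qed.

Lemma partial_damping_tail_ge0 n t : 0 < t -> 0 <= g t - gN n t.
Proof. by move=> t0; rewrite subr_ge0 partial_damping_le. Qed.

Lemma mode_energy_deriv i : has_deriv (fun t => en i t) (fun t => - 2 * g t * b i t ^+ 2).
Proof.
move=> t t0; have Da := dm_a S i t0; have Db := dm_b S i t0.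
by derive_as; rewrite /=; ring.
Qed.

Lemma partial_energy_deriv n :
  has_deriv (fun t => EN n t) (fun t => - 2 * g t * gN n t).
Proof.
move=> t t0; rewrite mulr_sumr.
apply: (is_derive_fsum (F := fun i t => en i t) (dF := fun i t => - 2 * g t * b i t ^+ 2)).
by move=> i _; exact: mode_energy_deriv.
Qed.

Lemma partial_energy_continuous n t : 0 < t -> {for t, continuous (fun t => EN n t)}.
Proof. by move=> t0; apply: has_deriv_continuous (partial_energy_deriv n) t0. Qed.

(** The remainder of the energy series dominates all other remainders below, and
    decreases to 0; this is what allows termwise differentiation. *)
Lemma termwise_derivative_energy (F f : nat -> R -> R) (Fl fl K : R -> R) :
  (forall n, has_deriv (F n) (f n)) ->
  (forall t, 0 < t -> F n t @[n --> \oo] --> Fl t) ->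
  (forall n t, 0 < t -> `|f n t - fl t| <= K t * (E t - EN n t)) ->
  (forall t, 0 < t -> 0 <= K t) ->
  (forall t, 0 < t -> {for t, continuous K}) ->
  (forall t, 0 < t -> {for t, continuous fl}) ->
  has_deriv Fl fl.
Proof.
move=> dF cF fK K0 Kc flc.
apply: (termwise_derivative (T := fun n t => K t * (E t - EN n t)) dF cF fK) => //.
- move=> m n t t0 mn; rewrite ler_wpM2l ?K0// lerB//; exact: partial_energy_mono.
- move=> t t0; rewrite -[X in _ --> X](mulr0 (K t)) -[X in _ * X](subrr (E t)).
  by apply: cvgMr; apply: cvgB; [exact: cvg_cst|exact: (dm_E S)].
- move=> n t t0; apply: cvgM; first exact: Kc.
  by apply: cvgB; [exact: (dm_Ec S)|exact: partial_energy_continuous].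
Qed.

Lemma energy_deriv : has_deriv E (fun t => - 2 * g t ^+ 2).
Proof.
apply: (termwise_derivative_energy (K := fun t => 2 * g t) partial_energy_deriv).
- exact: (dm_E S).
- move=> n t t0.
  rewrite (_ : _ - _ = 2 * g t * (g t - gN n t)); last by ring.
  have g0 := damping_ge0 t0.
  rewrite ger0_norm ?mulr_ge0 ?partial_damping_tail_ge0//.
  by apply: ler_wpM2l; rewrite ?mulr_ge0 ?damping_tail_le.
- by move=> t t0; rewrite mulr_ge0// damping_ge0.
- by move=> t t0; apply: cvgM; [exact: cvg_cst|exact: (dm_gc S)].
- move=> t t0; apply: cvgM; first exact: cvg_cst.
  by under [X in X @ _ --> _]eq_fun do rewrite expr2; apply: cvgM; exact: (dm_gc S).
Qed.

Lemma energy_nonincreasing s t : 0 < s -> s <= t -> E t <= E s.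
Proof.
apply: deriv_le0_nonincreasing energy_deriv _ => x _.
by have := sqr_ge0 (g x); lra.
Qed.

End Energy.

Section Decay.
Context {R : realType} {lam : nat -> R} {a b : nat -> R -> R} {g E : R -> R}.
Context (S : damped_modes lam a b g E).

Local Notation en i t := (a i t ^+ 2 + b i t ^+ 2).
Local Notation EN n t := (\sum_(i < n) (a i t ^+ 2 + b i t ^+ 2)).
Local Notation gN n t := (\sum_(i < n) b i t ^+ 2).
Local Notation pN n t := (\sum_(i < n) a i t * b i t / lam i).

Lemma frequency_ge0 i : lam 0%N <= lam i.
Proof. by case: i => // i; apply/ltW/(dm_incr S). Qed.

Lemma cross_term_le i t : `|a i t * b i t / lam i| <= en i t / (2 * lam 0%N).
Proof.
have l0 := dm_pos S 0; have li := dm_pos S i.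
rewrite normrM normfV (gtr0_norm li) normrM.
apply: (@le_trans _ _ (`|a i t| * `|b i t| / lam 0%N)).
  by rewrite ler_wpM2l ?mulr_ge0// lef_pV2 ?posrE// frequency_ge0.
rewrite invfM mulrA ler_pM2r ?invr_gt0//.
rewrite -(real_normK (num_real (a i t))) -(real_normK (num_real (b i t))).
by have := sqr_ge0 (`|a i t| - `|b i t|); lra.
Qed.

(** The scalar product of u and u', whose derivative trades kinetic for
    potential energy; the integrating factor removes the damping term, so that
    the series may be differentiated before its sum is known to be continuous. *)
Lemma multiplier_exists : exists p : R -> R,
  (forall t, 0 < t -> `|p t| <= E t / (2 * lam 0%N)) /\
  has_deriv p (fun t => 2 * g t - E t - g t * p t).
Proof.
have l0 := dm_pos S 0.
have /choice[p Hp] : forall t, exists s : R, 0 < t ->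
    pN n t @[n --> \oo] --> s /\ `|s| <= E t / (2 * lam 0%N).
  move=> t; have [t0|t0] := ltP 0 t; last first.
    by exists 0.
  have cE : \sum_(i < n) (en i t / (2 * lam 0%N)) @[n --> \oo] --> E t / (2 * lam 0%N).
    under [X in X @ _ --> _]eq_fun do rewrite -mulr_suml.
    by apply: cvgM; [exact: (dm_E S)|exact: cvg_cst].
  have [s [cs Hs]] := dominated_partial_sums (cross_term_le ^~ t) cE.
  by exists s => _; split => //; have := Hs 0%N; rewrite !big_ord0 !subr0.
have [G dG] := primitive_exists (dm_gc S).
have dP : has_deriv (fun t => expR (G t) * p t) (fun t => expR (G t) * (2 * g t - E t)).
  apply: (termwise_derivative_energy S (F := fun n t => expR (G t) * pN n t)
    (f := fun n t => expR (G t) * (2 * gN n t - EN n t)) (K := fun t => 3 * expR (G t))).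
  - move=> n t t0.
    have Da := dm_a S; have Db := dm_b S.
    have dpN : is_derive t (1 : R) (fun t => pN n t)
        (\sum_(i < n) (b i t ^+ 2 - a i t ^+ 2 - g t * (a i t * b i t / lam i))).
      apply: (is_derive_fsum (F := fun i t => a i t * b i t / lam i)
        (dF := fun i t => b i t ^+ 2 - a i t ^+ 2 - g t * (a i t * b i t / lam i))).
      move=> i _; derive_as; rewrite /=; field.
      by rewrite gt_eqF// (dm_pos S).
    derive_as; rewrite 2!sumrB -mulr_sumr big_split/=; ring.
  - by move=> t t0; apply: cvgMr; exact: (Hp t t0).1.
  - move=> n t t0; rewrite -mulrBr normrM (gtr0_norm (expR_gt0 _)).
    rewrite [3 * _]mulrC -mulrA ler_pM2l ?expR_gt0//.
    rewrite ler_norml; have := damping_tail_le S n t0; have := partial_damping_le S n t0.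
    by have := partial_energy_le S n t0; move=> *; apply/andP; split; lra.
  - by move=> t _; rewrite mulr_ge0// expR_ge0.
  - have dK : has_deriv (fun t => 3 * expR (G t)) (fun t => 3 * (expR (G t) * g t)).
      by move=> t t0; derive_as; ring.
    by move=> t; exact: has_deriv_continuous dK.
  - have dK : has_deriv (fun t => expR (G t)) (fun t => expR (G t) * g t).
      by move=> t t0; derive_as; ring.
    move=> t t0; apply: cvgM; first exact: (has_deriv_continuous dK).
    apply: cvgB; last exact: (dm_Ec S).
    by apply: cvgM; [exact: cvg_cst|exact: (dm_gc S)].
exists p; split => [t t0|t t0]; first exact: (Hp t t0).2.
move: dP; set P := (fun t => _) => dP.
have pE : p = (fun t => expR (- G t) * P t).
  by apply/funext => x; rewrite /P mulrA -expRD addNr expR0 mul1r.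
rewrite [X in is_derive _ _ X _]pE; derive_as.
have Ee : expR (- G t) * expR (G t) = 1 by rewrite -expRD addNr expR0.
apply: (@eq_trans _ _ (expR (- G t) * expR (G t) * (2 * g t - E t - g t * p t))).
  by rewrite /P; ring.
by rewrite Ee mul1r.
Qed.

(** The energy corrected by a small multiple of E<u,u'> satisfies W' <= - c E^2:
    the damping itself only controls the kinetic part of E^2, and the
    correction supplies the rest. *)
Lemma corrected_energy : exists (eps : R) (W w : R -> R),
  [/\ 0 < eps, has_deriv W w &
    forall t, 1 <= t ->
      [/\ w t <= - eps * E t ^+ 2, E t <= 2 * W t & W t <= 2 * E t]].
Proof.
have l0 := dm_pos S 0; have [p [pE dp]] := multiplier_exists.
have dE := energy_deriv S.
(* kappa bounds |<u,u'>| for t >= 1; d kappa <= 1/2 keeps W comparable with E *)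
pose kappa := E 1 / (2 * lam 0%N).
have E1 : 0 <= E 1 by exact: (energy_ge0 S).
have k0 : 0 <= kappa by rewrite divr_ge0// mulr_ge0// ltW.
pose d := ((2 + kappa) ^+ 2)^-1.
have d0 : 0 < d by rewrite invr_gt0 exprn_gt0//; lra.
have dk : d * (2 + kappa) ^+ 2 = 1 by rewrite mulVf// expf_neq0//; lra.
exists (d / 2), (fun t => E t * (1 + d * p t)),
  (fun t => - 2 * g t ^+ 2 * (1 + d * p t)
            + E t * (d * (2 * g t - E t - g t * p t))).
split; first by lra.
  by move=> t t0; derive_as; ring.
move=> t t1; have t0 : 0 < t by lra.
have pk : `|p t| <= kappa.
  apply: le_trans (pE t t0) _; rewrite ler_pM2r ?invr_gt0; last by lra.
  by apply: (energy_nonincreasing S) => //; lra.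
have Et := energy_ge0 S t0; have gt := damping_ge0 S t0.
have [pl pu] : - kappa <= p t /\ p t <= kappa by move: pk; rewrite ler_norml => /andP.
have dkappa : d * kappa <= 1 / 2.
  by have := ltW d0; move: dk; rewrite expr2; nra.
have [dl du] : - (1 / 2) <= d * p t /\ d * p t <= 1 / 2.
  have := ler_wpM2l (ltW d0) pl; have := ler_wpM2l (ltW d0) pu.
  by split; lra.
split; first last.
- by have := ler_wpM2l Et du; lra.
- by have := ler_wpM2l Et dl; lra.
have g2 := sqr_ge0 (g t).
have kin : g t ^+ 2 * (1 / 2) <= g t ^+ 2 * (1 + d * p t) by rewrite ler_wpM2l//; lra.
have cross : E t * (2 * g t - g t * p t) <= E t ^+ 2 / 2 + (2 + kappa) ^+ 2 * g t ^+ 2 / 2.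
  have := sqr_ge0 (E t - (2 + kappa) * g t).
  have : E t * g t * - p t <= E t * g t * kappa by rewrite ler_wpM2l ?mulr_ge0//; lra.
  by lra.
have := ler_wpM2l (ltW d0) cross.
have -> : d * (E t ^+ 2 / 2 + (2 + kappa) ^+ 2 * g t ^+ 2 / 2) =
  d * E t ^+ 2 / 2 + (d * (2 + kappa) ^+ 2) * g t ^+ 2 / 2 by ring.
rewrite dk; lra.
Qed.

(** Integrability of E^2, the bound for all the error terms of the averaging. *)
Lemma energy_square_primitive : exists (Q : R -> R) (q : R),
  has_deriv Q (fun t => E t ^+ 2) /\ Q t @[t --> +oo] --> q.
Proof.
have dE := energy_deriv S.
have dE2 : has_deriv (fun t => E t ^+ 2) (fun t => 2 * E t * (- 2 * g t ^+ 2)).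
  by move=> t t0; derive_as; rewrite expr1.
have [Q dQ] := primitive_exists (fun t => has_deriv_continuous dE2 (t := t)).
have [eps [W [w [e0 dW HW]]]] := corrected_energy.
have Qm s t : 1 <= s -> s <= t -> Q s <= Q t.
  move=> s1; apply: (deriv_ge0_nondecreasing dQ); last by lra.
  by move=> x _; exact: sqr_ge0.
have [|q [Qq _]] := @nondecreasing_bounded_cvg _ Q (Q 1 + W 1 / eps) Qm.
  move=> t t1.
  have dQe : has_deriv (fun t => eps * Q t) (fun t => eps * E t ^+ 2).
    by move=> x x0; derive_as; ring.
  have dnW : has_deriv (fun t => - W t) (fun t => - w t).
    by move=> x x0; derive_as.
  have H x : 1 <= x <= t -> eps * E x ^+ 2 <= - w x.
    by move=> /andP[x1 _]; have [] := HW x x1; lra.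
  have incr := increment_le dQe dnW H ltr01 t1.
  have [_ W0 _] := HW t t1; have E0 := energy_ge0 S (lt_le_trans ltr01 t1).
  by rewrite -lerBlDl ler_pdivlMr//; lra.
by exists Q, q.
Qed.

(** Since W is comparable with E, the derivative of 1 / W is bounded below by a
    positive constant. *)
Lemma energy_le_inv : (forall t, 0 < t -> 0 < E t) ->
  exists C : R, forall t, 1 <= t -> t * E t <= C.
Proof.
move=> Epos; have [eps [W [w [e0 dW HW]]]] := corrected_energy.
have Wpos t : 1 <= t -> 0 < W t.
  by move=> t1; have [_ ? _] := HW t t1; have := Epos t (lt_le_trans ltr01 t1); lra.
pose k := Num.min (W 1)^-1 (eps / 4).
have k0 : 0 < k by rewrite lt_min invr_gt0 Wpos//=; lra.
have [k1 k2] : k <= (W 1)^-1 /\ k <= eps / 4 by rewrite !ge_min !lexx orbT.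
exists (2 / k) => t t1.
have [|c /andP[c1 _] incr] := @MVT_on_segment _ (fun t => (W t)^-1)
    (fun x => - (W x) ^- 2 * w x) 1 t _ t1.
  by move=> x /andP[x1 _]; derive_as; [rewrite gt_eqF// Wpos|exact: lt_le_trans ltr01 x1|].
have Wt := Wpos t t1; have Wc := Wpos c c1.
have slope : eps / 4 <= - (W c) ^- 2 * w c.
  have [wc Ec Wc2] := HW c c1.
  rewrite mulNr -mulrN ler_pdivlMl ?exprn_gt0//.
  have : W c ^+ 2 <= (2 * E c) ^+ 2 by rewrite ler_sqr ?nnegrE; lra.
  by rewrite exprMn; nra.
have Wk : k * t <= (W t)^-1.
  have : k * (t - 1) <= - (W c) ^- 2 * w c * (t - 1) by rewrite ler_wpM2r; lra.
  by lra.
have WtV : t * W t * k <= 1.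
  have := ler_wpM2r (ltW Wt) Wk; rewrite mulVf ?gt_eqF//; lra.
have [_ EW _] := HW t t1.
rewrite ler_pdivlMr//.
have : t * E t * k <= t * (2 * W t) * k.
  by rewrite ler_pM2r// ler_wpM2l//; lra.
by lra.
Qed.

(** Since g <= E, the derivative of 1 / E is at most 2. *)
Lemma energy_ge_inv : (forall t, 0 < t -> 0 < E t) ->
  exists2 c : R, 0 < c & forall t, 1 <= t -> c <= t * E t.
Proof.
move=> Epos; have dE := energy_deriv S.
have dV : has_deriv (fun t => (E t)^-1) (fun t => - (E t) ^- 2 * (- 2 * g t ^+ 2)).
  by move=> t t0; derive_as; [rewrite gt_eqF// Epos|].
have d2 : has_deriv (fun t : R => 2 * t) (fun=> 2).
  by move=> t t0; derive_as; ring.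
have H x : 1 <= x -> - (E x) ^- 2 * (- 2 * g x ^+ 2) <= 2.
  move=> x1; have x0 : 0 < x by lra.
  have -> : - (E x) ^- 2 * (- 2 * g x ^+ 2) = 2 * (g x ^+ 2 / E x ^+ 2) by ring.
  rewrite -[leRHS]mulr1 ler_pM2l// ler_pdivrMr ?exprn_gt0 ?Epos// mul1r.
  rewrite ler_sqr ?nnegrE ?(damping_ge0 S)// ?(energy_ge0 S)//.
  exact: damping_le_energy S _ x0.
pose k := 2 + (E 1)^-1.
have k0 : 0 < k by rewrite addr_gt0// invr_gt0 Epos.
exists k^-1; first by rewrite invr_gt0.
move=> t t1; have t0 : 0 < t by lra.
have := increment_le dV d2 (s := 1) (t := t) _ ltr01 t1.
have /[swap]/[apply] : forall x, 1 <= x <= t -> - (E x) ^- 2 * (- 2 * g x ^+ 2) <= 2.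
  by move=> x /andP[/H].
move=> incr.
have Vk : (E t)^-1 <= k * t.
  have : (E 1)^-1 * 1 <= (E 1)^-1 * t by rewrite ler_wpM2l// invr_ge0 (energy_ge0 S).
  by rewrite /k; lra.
have Et := Epos t t0.
rewrite -[leLHS]mul1r ler_pdivrMr//.
by have := ler_wpM2r (ltW Et) Vk; rewrite mulVf ?gt_eqF//; lra.
Qed.

End Decay.

(** * Averaging of the oscillating terms *)

Section Averaging.
Context {R : realType} {lam : nat -> R} {a b : nat -> R -> R} {g E : R -> R}.
Context (S : damped_modes lam a b g E).

Local Notation en i t := (a i t ^+ 2 + b i t ^+ 2).
Local Notation EN n t := (\sum_(i < n) (a i t ^+ 2 + b i t ^+ 2)).
Local Notation gN n t := (\sum_(i < n) b i t ^+ 2).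

(** The sums of the primitives [V i] converge monotonically, and their limit is a
    primitive of g by termwise differentiation. *)
Lemma damping_increments (G : R -> R) (V : nat -> R -> R) s t :
  has_deriv G g -> (forall i, has_deriv (V i) (fun t => b i t ^+ 2)) ->
  0 < s -> s <= t ->
  \sum_(i < n) (V i t - V i s) @[n --> \oo] --> G t - G s.
Proof.
move=> dG dV s0 st.
have Vm i u v : 0 < u -> u <= v -> V i u <= V i v.
  by move=> u0 uv; apply: (deriv_ge0_nondecreasing (dV i)) => // x _; exact: sqr_ge0.
have dVn n : has_deriv (fun t => \sum_(i < n) V i t) (fun t => gN n t).
  by move=> x x0; apply: (is_derive_fsum (F := V) (dF := fun i t => b i t ^+ 2)) => i _; exact: dV.
have VG n u v : 0 < u -> u <= v -> \sum_(i < n) (V i v - V i u) <= G v - G u.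
  move=> u0 uv; rewrite sumrB; apply: (increment_le (dVn n) dG) => // x /andP[ux _].
  by apply: (partial_damping_le S); exact: lt_le_trans ux.
have cV x : 0 < x -> cvg (\sum_(i < n) (V i x - V i 1) @[n --> \oo]).
  move=> x0; have [x1|/ltW x1] := leP 1 x.
    apply: (nonneg_sums_cvg (u := fun i => V i x - V i 1)) (fun n => VG n 1 x ltr01 x1).
    by move=> i; rewrite subr_ge0 Vm.
  have : cvg (\sum_(i < n) (V i 1 - V i x) @[n --> \oo]).
    apply: (nonneg_sums_cvg (u := fun i => V i 1 - V i x)) (fun n => VG n x 1 x0 x1).
    by move=> i; rewrite subr_ge0 Vm.
  move=> /is_cvgN; suff -> : (fun n => \sum_(i < n) (V i x - V i 1)) =
    - (fun n => \sum_(i < n) (V i 1 - V i x)) by [].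
  by apply/funext => n; rewrite /= -[RHS]sumrN; apply: eq_bigr => i _; rewrite opprB.
pose Vl x := lim (\sum_(i < n) (V i x - V i 1) @[n --> \oo]).
have dVl : has_deriv Vl g.
  apply: (termwise_derivative_energy S (F := fun n x => \sum_(i < n) (V i x - V i 1))
    (f := fun n x => gN n x) (K := fun=> 1)) => //.
  - move=> n x x0.
    apply: (is_derive_fsum (F := fun i x => V i x - V i 1) (dF := fun i t => b i t ^+ 2)).
    by move=> i _; derive_as; rewrite ?subr0 ?oppr0 ?addr0.
  - move=> n x x0; rewrite mul1r distrC ger0_norm ?(partial_damping_tail_ge0 S)//.
    exact: damping_tail_le S _ _ x0.
  - by move=> x x0; exact: cvg_cst.
  - exact: (dm_gc S).
have dVG : has_deriv (fun x => Vl x - G x) (fun x => g x - g x).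
  by move=> x x0; derive_as.
have E1 : Vl t - G t = Vl s - G s.
  by apply: (deriv0_constant dVG) => // x _; rewrite subrr.
have -> : G t - G s = Vl t - Vl s by lra.
have t0 : 0 < t by exact: lt_le_trans st.
have -> : (fun n => \sum_(i < n) (V i t - V i s)) =
    (fun n => \sum_(i < n) (V i t - V i 1) - \sum_(i < n) (V i s - V i 1)).
  by apply/funext => n; rewrite -sumrB; apply: eq_bigr => i _; ring.
by apply: cvgB; exact: cV.
Qed.

Lemma kinetic_primitives : exists V : nat -> R -> R,
  forall i, has_deriv (V i) (fun t => b i t ^+ 2).
Proof.
suff /choice[V dV] : forall i, exists V : R -> R, has_deriv V (fun t => b i t ^+ 2).
  by exists V.
move=> i; apply: primitive_exists => t t0; have Db := dm_b S i.
apply: (@has_deriv_continuous _ _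
  (fun t => 2 * b i t * (- lam i * a i t - g t * b i t))) => //.
by move=> x x0; derive_as; rewrite expr1.
Qed.

(** The frequencies may accumulate, but strict monotonicity isolates each of
    them. *)
Lemma frequency_gap k : exists2 gap : R, 0 < gap &
  forall i, i != k -> gap <= `|lam k - lam i|.
Proof.
have below (i : nat) : (i < k)%N -> lam k - lam k.-1 <= `|lam k - lam i|.
  move=> ik; rewrite ger0_norm; last by rewrite subr_ge0; exact/ltW/(dm_incr S).
  rewrite lerB//; have : (i <= k.-1)%N by rewrite -ltnS prednK//; exact: leq_ltn_trans ik.
  by rewrite leq_eqVlt => /predU1P[->//|/(dm_incr S)/ltW].
have above (i : nat) : (k < i)%N -> lam k.+1 - lam k <= `|lam k - lam i|.
  move=> ki; rewrite distrC ger0_norm; last by rewrite subr_ge0; exact/ltW/(dm_incr S).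
  by rewrite lerB//; move: ki; rewrite leq_eqVlt => /predU1P[->//|/(dm_incr S)/ltW].
have [k0|k0] := posnP k.
  exists (lam k.+1 - lam k); first by rewrite subr_gt0 (dm_incr S).
  by move=> i ik; apply: above; rewrite k0 lt0n -k0.
exists (Num.min (lam k - lam k.-1) (lam k.+1 - lam k)).
  by rewrite lt_min !subr_gt0 !(dm_incr S)// prednK.
move=> i; rewrite neq_ltn => /orP[/below|/above]; apply: le_trans.
  by rewrite ge_min lexx.
by rewrite ge_min lexx orbT.
Qed.

(** [(c, s)] behaves as (cos 2 l t, sin 2 l t), up to relative errors of the
    size of the damping. Both (cos 2 theta, sin 2 theta) and its quarter turn are of
    this form, which treats amplitudes and phases at once. *)
Definition rotating (l : R) (c s : R -> R) : Prop :=
  exists x y : R -> R,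
  [/\ has_deriv c (fun t => - 2 * l * s t + g t * x t),
      has_deriv s (fun t => 2 * l * c t + g t * y t) &
      forall t, 0 < t -> [/\ `|c t| <= 1, `|s t| <= 1, `|x t| <= 1 & `|y t| <= 1]].

Lemma rotating_quarter l c s : rotating l c s -> rotating l s (fun t => - c t).
Proof.
move=> [x [y [dc ds B]]]; exists y, (fun t => - x t); split.
- by move=> t t0; derive_as; ring.
- by move=> t t0; derive_as; ring.
- by move=> t t0; have [] := B t t0; rewrite !normrN.
Qed.

Lemma mode_product_le i t : `|2 * a i t * b i t| <= en i t.
Proof.
by rewrite ler_norml; have := sqr_ge0 (a i t - b i t); have := sqr_ge0 (a i t + b i t); lra.
Qed.

Lemma mode_difference_le i t : `|a i t ^+ 2 - b i t ^+ 2| <= en i t.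
Proof.
by rewrite ler_norml; have := sqr_ge0 (a i t); have := sqr_ge0 (b i t); lra.
Qed.

Lemma mode_kinetic_le i t : `|b i t ^+ 2| <= en i t.
Proof.
by rewrite ler_norml; have := sqr_ge0 (a i t); have := sqr_ge0 (b i t); lra.
Qed.

(** Mode [i] oscillates with frequency [lam i], so b_i^2 c is a combination of
    terms of frequencies 2 l and 2 (l +- lam i), none of which vanishes. *)
Lemma nonresonant_corrector (l gap : R) (c s : R -> R) i : 0 < l -> 0 < gap ->
  gap <= `|l - lam i| -> rotating l c s ->
  exists phi dphi : R -> R, [/\ has_deriv phi dphi,
    forall t, 0 < t -> `|phi t| <= 3 * (l^-1 + gap^-1) * en i t &
    forall t, 0 < t ->
      `|dphi t - b i t ^+ 2 * c t| <= 3 * (l^-1 + gap^-1) * (g t * en i t)].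
Proof.
move=> l0 gap0 Hgap [x [y [dc ds B]]].
have li0 := dm_pos S i.
have dli : l - lam i != 0 by rewrite -normr_gt0; exact: lt_le_trans Hgap.
have sli : l + lam i != 0 by rewrite gt_eqF// addr_gt0.
have D0 : l ^+ 2 - lam i ^+ 2 != 0 by rewrite subr_sqr mulf_neq0.
pose al := l / (l ^+ 2 - lam i ^+ 2); pose be := lam i / (l ^+ 2 - lam i ^+ 2).
have frac (z : R) : 0 <= z -> z <= l + lam i -> `|z / (l ^+ 2 - lam i ^+ 2)| <= gap^-1.
  move=> z0 zl; rewrite subr_sqr normrM normfV normrM (ger0_norm z0).
  rewrite (@gtr0_norm _ (l + lam i)) ?addr_gt0//.
  rewrite ler_pdivrMr ?mulr_gt0 ?normr_gt0 ?addr_gt0// mulrA.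
  apply: (le_trans zl); rewrite -[leLHS]mul1r ler_pM2r ?addr_gt0//.
  by rewrite ler_pdivlMl// mulr1.
have alB : `|al| <= gap^-1 by apply: frac; rewrite ?lerDl ltW.
have beB : `|be| <= gap^-1 by apply: frac; rewrite ?lerDr ltW.
pose il := l^-1; have il0 : 0 < il by rewrite invr_gt0.
have ilB : `|il| <= il by rewrite gtr0_norm.
have ig0 : 0 < gap^-1 by rewrite invr_gt0.
have ilE : l * il = 1 by rewrite mulfV// gt_eqF.
have dab : l * al - lam i * be = 1 by rewrite /al /be; field.
have sab : lam i * al = l * be by rewrite /al /be; field.
have Da := dm_a S i; have Db := dm_b S i.
pose e t := en i t; pose d t := a i t ^+ 2 - b i t ^+ 2; pose m t := 2 * a i t * b i t.
have de : has_deriv e (fun t => - 2 * g t * b i t ^+ 2) := mode_energy_deriv S i.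
have dd : has_deriv d (fun t => 2 * lam i * m t + 2 * g t * b i t ^+ 2).
  by rewrite /d => t t0; derive_as; rewrite /= /m; ring.
have dm : has_deriv m (fun t => - 2 * lam i * d t - g t * m t).
  by rewrite /m => t t0; derive_as; rewrite /= /d; ring.
exists (fun t => e t * s t * il / 4 - (al * (d t * s t) + be * (m t * c t)) / 4).
exists (fun t => b i t ^+ 2 * c t + g t *
  ((e t * y t - 2 * b i t ^+ 2 * s t) * il / 4
   - (al * (2 * b i t ^+ 2 * s t + d t * y t) + be * (m t * x t - m t * c t)) / 4)).
split.
- move=> t t0; derive_as.
  have eqE : b i t ^+ 2 * c t = (l * il) * (e t * c t) / 2 - (l * al - lam i * be) * (d t * c t) / 2
      - (lam i * al - l * be) * (m t * s t) / 2.
    by rewrite ilE dab sab /e /d; field.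
  by rewrite eqE; field.
- move=> t t0; have [cB sB _ _] := B t t0.
  have e0 : 0 <= e t by exact: energy_mode_ge0.
  have eB : `|e t| <= e t by rewrite ger0_norm.
  have T1 := norm_mul_le (norm_mul_le eB sB) ilB.
  have T2 := norm_mul_le alB (norm_mul_le (mode_difference_le i t) sB).
  have T3 := norm_mul_le beB (norm_mul_le (mode_product_le i t) cB).
  have P1 := mulr_ge0 (ltW il0) e0; have P2 := mulr_ge0 (ltW ig0) e0.
  move: T1 T2 T3; rewrite -/(e t) -/(d t) -/(m t) -/il !ler_norml.
  move=> /andP[? ?] /andP[? ?] /andP[? ?]; apply/andP; split; lra.
- move=> t t0; have [cB sB xB yB] := B t t0; have g0 := damping_ge0 S t0.
  have e0 : 0 <= e t by exact: energy_mode_ge0.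
  have eB : `|e t| <= e t by rewrite ger0_norm.
  rewrite (addrC (b i t ^+ 2 * c t)) addrK normrM (ger0_norm g0).
  rewrite [leRHS](_ : _ = g t * (3 * (il + gap^-1) * e t)); last by rewrite /il /e; ring.
  apply: ler_wpM2l => //.
  have kB := mode_kinetic_le i t; have dB := mode_difference_le i t.
  have mB := mode_product_le i t.
  have T1 := norm_mul_le (norm_mul_le eB yB) ilB.
  have T2 := norm_mul_le (norm_mul_le kB sB) ilB.
  have T3 := norm_mul_le alB (norm_mul_le kB sB).
  have T4 := norm_mul_le alB (norm_mul_le dB yB).
  have T5 := norm_mul_le beB (norm_mul_le mB xB).
  have T6 := norm_mul_le beB (norm_mul_le mB cB).
  have P1 := mulr_ge0 (ltW il0) e0; have P2 := mulr_ge0 (ltW ig0) e0.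
  move: T1 T2 T3 T4 T5 T6; rewrite -/(e t) -/(d t) -/(m t) !ler_norml.
  move=> /andP[? ?] /andP[? ?] /andP[? ?] /andP[? ?] /andP[? ?] /andP[? ?].
  apply/andP; split; lra.
Qed.

End Averaging.

Section Corrector.
Context {R : realType} {lam : nat -> R} {a b : nat -> R -> R} {g E : R -> R}.
Context (S : damped_modes lam a b g E) (Epos : forall t, 0 < t -> 0 < E t).

Local Notation en i t := (a i t ^+ 2 + b i t ^+ 2).
Local Notation EN n t := (\sum_(i < n) (a i t ^+ 2 + b i t ^+ 2)).
Local Notation gN n t := (\sum_(i < n) b i t ^+ 2).

Lemma energy_vanishes : E t @[t --> +oo] --> (0 : R).
Proof.
have [C HC] := energy_le_inv S Epos.
apply: (squeeze_cvgr (f := fun=> 0) (h := fun t => C * t^-1)).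
- near=> t; have t1 : 1 <= t by near: t; exact: nbhs_pinfty_ge.
  have t0 : 0 < t by lra.
  by rewrite (energy_ge0 S t0) ler_pdivlMr// mulrC HC.
- exact: cvg_cst.
- by rewrite -[X in _ --> X](mulr0 C); apply: cvgMr; exact: cvg_inv_infty.
Unshelve. all: by end_near. Qed.

(** Since [c] oscillates at the frequency of mode [k], only that mode can
    contribute a non-oscillating term to g c, which is compensated by [sigma].
    The error terms are quadratic in the energy, hence integrable. *)
Lemma oscillating_damping_cvg k (c s sigma phi dphi L : R -> R) (C : R) :
  rotating (g := g) (lam k) c s -> has_deriv phi dphi -> 0 <= C ->
  (forall t, 0 < t -> `|phi t| <= C * E t) ->
  (forall t, 0 < t -> `|dphi t - b k t ^+ 2 * c t - sigma t| <= C * E t ^+ 2) ->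
  has_deriv L (fun t => g t * c t + sigma t) ->
  exists l : R, L t @[t --> +oo] --> l.
Proof.
move=> rot dphi_ C0 phiB dphiB dL.
have [gap gap0 Hgap] := frequency_gap S k.
pose C1 := 3 * ((lam k)^-1 + gap^-1).
have C10 : 0 <= C1.
  by rewrite mulr_ge0// addr_ge0// invr_ge0 ltW// (dm_pos S).
have /choice[f Hf] : forall i, exists f : (R -> R) * (R -> R),
  [/\ has_deriv f.1 f.2,
    forall t, 0 < t -> `|f.1 t| <= C1 * en i t + (i == k)%:R * (C * E t) &
    forall t, 0 < t -> `|f.2 t - b i t ^+ 2 * c t - (i == k)%:R * sigma t|
      <= C1 * (g t * en i t) + (i == k)%:R * (C * E t ^+ 2)].
  move=> i; have [->|ik] := eqVneq i k.
    exists (phi, dphi); split => //= t t0; rewrite !mul1r.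
      by apply: le_trans (phiB t t0) _; rewrite lerDr mulr_ge0// energy_mode_ge0.
    apply: le_trans (dphiB t t0) _; rewrite lerDr mulr_ge0// mulr_ge0//.
      exact: damping_ge0 S _ t0.
    exact: energy_mode_ge0.
  have [f [df [Hd HB1 HB2]]] :=
    nonresonant_corrector S (dm_pos S k) gap0 (Hgap i ik) rot.
  exists (f, df); split => //= t t0; rewrite !mul0r ?addr0 ?subr0.
    exact: HB1.
  exact: HB2.
pose K := C1 + C; have K0 : 0 <= K by exact: addr_ge0.
pose Phi n t := \sum_(i < n) (f i).1 t.
pose dPhi n t := \sum_(i < n) (f i).2 t.
have dPhi_ n : has_deriv (Phi n) (dPhi n).
  move=> t t0; apply: (is_derive_fsum (F := fun i => (f i).1) (dF := fun i => (f i).2)).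
  by move=> i _; have [H _ _] := Hf i; exact: H.
have PhiB n t : (k < n)%N -> 0 < t -> `|Phi n t| <= K * E t.
  move=> kn t0; apply: le_trans (ler_norm_sum _ _ _) _.
  apply: (@le_trans _ _ (\sum_(i < n) (C1 * en i t + (nat_of_ord i == k)%:R * (C * E t)))).
    by apply: ler_sum => i _; have [_ H _] := Hf i; exact: H.
  rewrite big_split /= sum_indicator// -mulr_sumr mulrDl lerD2r.
  by rewrite ler_wpM2l// (partial_energy_le S).
have dPhiB n t : (k < n)%N -> 0 < t ->
    `|dPhi n t - gN n t * c t - sigma t| <= K * E t ^+ 2.
  move=> kn t0.
  rewrite -[sigma t](sum_indicator _ kn) mulr_suml -!sumrB.
  apply: le_trans (ler_norm_sum _ _ _) _.
  apply: (@le_trans _ _ (\sum_(i < n)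
      (C1 * (g t * en i t) + (nat_of_ord i == k)%:R * (C * E t ^+ 2)))).
    by apply: ler_sum => i _; have [_ _ H] := Hf i; exact: H.
  rewrite big_split /= sum_indicator// -mulr_sumr mulrDl lerD2r.
  rewrite ler_wpM2l// -mulr_sumr expr2 ler_pM ?(damping_ge0 S t0)//.
  - by apply: sumr_ge0 => i _; exact: energy_mode_ge0.
  - exact: (damping_le_energy S t0).
  - exact: partial_energy_le S _ _ t0.
have [Q [q [dQ Qq]]] := energy_square_primitive S.
have [G dG] := primitive_exists (dm_gc S).
have [V dV] := kinetic_primitives S.
have [xr [yr [_ _ B]]] := rot.
apply: (@cvg_of_increments _ L (fun t => K * E t) (fun t => K * Q t) (K * q)).
- move=> s1 t s11 st.
  have s0 : 0 < s1 by lra.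
  have t0 : 0 < t by lra.
  have incr n : (k < n)%N -> `|L t - L s1| <= K * E t + K * E s1
      + (G t - G s1 - \sum_(i < n) (V i t - V i s1) + (K * Q t - K * Q s1)).
    move=> kn.
    have dD : has_deriv (fun t => L t - Phi n t)
        (fun t => g t * c t + sigma t - dPhi n t).
      by move=> x x0; derive_as.
    have dVn : has_deriv (fun t => \sum_(i < n) V i t) (fun t => gN n t).
      move=> x x0; apply: (is_derive_fsum (F := V) (dF := fun i t => b i t ^+ 2)).
      by move=> i _; exact: dV.
    have dH : has_deriv (fun t => G t - (\sum_(i < n) V i t) + K * Q t)
        (fun t => g t - gN n t + K * E t ^+ 2).
      move=> x x0; apply: is_derive_fD; last by derive_as; ring.
      by apply: is_derive_fD; [exact: dG|apply: is_derive_fN; exact: dVn].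
    have HB x : s1 <= x <= t -> `|g x * c x + sigma x - dPhi n x| <=
        g x - gN n x + K * E x ^+ 2.
      move=> /andP[sx _]; have x0 : 0 < x by lra.
      have [cB _ _ _] := B x x0.
      have T := norm_mul_le (lexx `|g x - gN n x|) cB.
      rewrite (ger0_norm (partial_damping_tail_ge0 S n x0)) mulr1 in T.
      have := dPhiB n x kn x0; move: T; rewrite !ler_norml.
      by move=> /andP[? ?] /andP[? ?]; apply/andP; split; lra.
    have := increment_norm_le dD dH HB s0 st.
    have := PhiB n t kn t0; have := PhiB n s1 kn s0.
    rewrite sumrB !ler_norml.
    by move=> /andP[? ?] /andP[? ?] /andP[? ?]; apply/andP; split; lra.
  have cincr := damping_increments S dG dV s0 st.
  have lim_r : K * E t + K * E s1
      + (G t - G s1 - \sum_(i < n) (V i t - V i s1) + (K * Q t - K * Q s1))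
      @[n --> \oo] --> K * E t + K * E s1 + (0 + (K * Q t - K * Q s1)).
    apply: cvgD; first exact: cvg_cst.
    apply: cvgD; last exact: cvg_cst.
    rewrite -[X in _ --> X](subrr (G t - G s1)).
    by apply: cvgB => //; exact: cvg_cst.
  rewrite add0r in lim_r.
  by apply: (cvgr_to_ge lim_r); exists k.+1 => // n /= kn; exact: incr.
- by rewrite -[X in _ --> X](mulr0 K); apply: cvgMr; exact: energy_vanishes.
- exact: cvgMr.
Qed.

(** The difference of potential and kinetic energy of a mode is, up to errors of
    order E^2, the derivative of a multiple of a_i b_i. *)
Lemma kinetic_half_cvg i (V X : R -> R) : has_deriv V (fun t => b i t ^+ 2) ->
  has_deriv X (fun t => en i t) ->
  exists l : R, V t - X t / 2 @[t --> +oo] --> l.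
Proof.
move=> dV dX; have l0 := dm_pos S i.
have Da := dm_a S i; have Db := dm_b S i.
have [Q [q [dQ Qq]]] := energy_square_primitive S.
pose m t := 2 * a i t * b i t; pose il := (lam i)^-1.
have il0 : 0 < il by rewrite invr_gt0.
have ilE : lam i * il = 1 by rewrite mulfV// gt_eqF.
have dD : has_deriv (fun t => V t - X t / 2 - il / 4 * m t)
    (fun t => g t * (il / 4 * m t)).
  move=> t t0; rewrite /m; derive_as; rewrite /=.
  have -> : b i t ^+ 2 = lam i * il * b i t ^+ 2 by rewrite ilE mul1r.
  have eqE : a i t ^+ 2 = lam i * il * a i t ^+ 2 by rewrite ilE mul1r.
  by lra.
have dH : has_deriv (fun t => il * Q t) (fun t => il * E t ^+ 2).
  by move=> t t0; derive_as; ring.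
have mB t : 0 < t -> `|il / 4 * m t| <= il * E t.
  move=> t0; rewrite normrM gtr0_norm; last by lra.
  apply: (@le_trans _ _ (il * `|m t|)).
    by rewrite ler_wpM2r//; lra.
  rewrite ler_pM2l//; apply: le_trans (mode_energy_le S i t0).
  exact: mode_product_le.
apply: (@cvg_of_increments _ _ (fun t => il * E t) (fun t => il * Q t) (il * q)).
- move=> s t s1 st; have s0 : 0 < s by lra.
  have t0 : 0 < t by lra.
  have H x : s <= x <= t -> `|g x * (il / 4 * m x)| <= il * E x ^+ 2.
    move=> /andP[sx _]; have x0 : 0 < x by lra.
    have g0 := damping_ge0 S x0.
    rewrite normrM (ger0_norm g0).
    apply: (@le_trans _ _ (E x * (il * E x))); last by lra.
    by rewrite ler_pM ?mB// (damping_le_energy S).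
  have := increment_norm_le dD dH H s0 st.
  have := mB t t0; have := mB s s0; rewrite !ler_norml.
  by move=> /andP[? ?] /andP[? ?] /andP[? ?]; apply/andP; split; lra.
- by rewrite -[X in _ --> X](mulr0 il); apply: cvgMr; exact: energy_vanishes.
- exact: cvgMr.
Qed.

End Corrector.

(** * Asymptotic relations along an active mode *)

Section ActiveMode.
Context {R : realType} {lam : nat -> R} {a b : nat -> R -> R} {g E : R -> R}.
Context (S : damped_modes lam a b g E) (k : nat).
Context (ek0 : forall t, 0 < t -> 0 < a k t ^+ 2 + b k t ^+ 2).

Local Notation e t := (a k t ^+ 2 + b k t ^+ 2).

(** With u_k' = - sqrt(e_k) sin(theta) and lambda_k u_k = sqrt(e_k) cos(theta),
    these are cos(2 theta) and sin(2 theta). *)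
Definition cos2 t := (a k t ^+ 2 - b k t ^+ 2) / e t.
Definition sin2 t := - (2 * a k t * b k t) / e t.

Lemma active_energy_gt0 t : 0 < t -> 0 < E t.
Proof. by move=> t0; apply: lt_le_trans (ek0 t0) (mode_energy_le S k t0). Qed.

Lemma cos2_sqr t : 0 < t -> cos2 t ^+ 2 + sin2 t ^+ 2 = 1.
Proof. by move=> /ek0 e0; rewrite /cos2 /sin2; field; rewrite gt_eqF. Qed.

Lemma cos2_le1 t : 0 < t -> `|cos2 t| <= 1.
Proof.
move=> t0; rewrite -(expr_le1 (n := 2))// real_normK ?num_real//.
by have := cos2_sqr t0; have := sqr_ge0 (sin2 t); lra.
Qed.

Lemma sin2_le1 t : 0 < t -> `|sin2 t| <= 1.
Proof.
move=> t0; rewrite -(expr_le1 (n := 2))// real_normK ?num_real//.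
by have := cos2_sqr t0; have := sqr_ge0 (cos2 t); lra.
Qed.

Lemma mode_kinetic t : 0 < t -> b k t ^+ 2 = e t * (1 - cos2 t) / 2.
Proof. by move=> /ek0 e0; rewrite /cos2; field; rewrite gt_eqF. Qed.

Lemma cos2_deriv :
  has_deriv cos2 (fun t => - 2 * lam k * sin2 t + g t * sin2 t ^+ 2).
Proof.
have Da := dm_a S k; have Db := dm_b S k.
move=> t t0; rewrite /cos2; derive_as; first by rewrite gt_eqF ?ek0.
by rewrite /= /sin2; field; rewrite gt_eqF ?ek0.
Qed.

Lemma sin2_deriv :
  has_deriv sin2 (fun t => 2 * lam k * cos2 t + g t * - (sin2 t * cos2 t)).
Proof.
have Da := dm_a S k; have Db := dm_b S k.
move=> t t0; rewrite /sin2; derive_as; first by rewrite gt_eqF ?ek0.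
by rewrite /= /cos2; field; rewrite gt_eqF ?ek0.
Qed.

Lemma rotating_cos2 : rotating (g := g) (lam k) cos2 sin2.
Proof.
exists (fun t => sin2 t ^+ 2), (fun t => - (sin2 t * cos2 t)).
split; [exact: cos2_deriv|exact: sin2_deriv|move=> t t0].
have cB := cos2_le1 t0; have sB := sin2_le1 t0; split=> //.
  by rewrite normrX expr_le1.
by rewrite normrN -[leRHS]mulr1 norm_mul_le.
Qed.

Lemma mode_energy_square_le t : 0 < t -> g t * e t <= E t ^+ 2.
Proof.
move=> t0; rewrite expr2 ler_pM ?(damping_ge0 S t0) ?(damping_le_energy S t0)//.
  exact: energy_mode_ge0.
exact: mode_energy_le S _ _ t0.
Qed.

(** The logarithmic derivative of e_k is - 2 g sin^2(theta), that is
    - g + g cos(2 theta). The average of g cos(2 theta) is - e_k / 4, because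
    only the term i = k of g = sum_i e_i sin^2(theta_i) resonates with it. *)
Lemma log_energy_cvg (G X : R -> R) : has_deriv G g -> has_deriv X (fun t => e t) ->
  exists l : R, ln (e t) + G t + X t / 4 @[t --> +oo] --> l.
Proof.
move=> dG dX; have l0 := dm_pos S k.
pose il := (lam k)^-1; have il0 : 0 < il by rewrite invr_gt0.
have ilE : lam k * il = 1 by rewrite mulfV// gt_eqF.
have de := mode_energy_deriv S k; have dc := cos2_deriv; have ds := sin2_deriv.
pose c := cos2; pose s := sin2; pose f t := e t.
rewrite -/c -/s -/f in de dc ds dX.
have ilB : `|il| <= il by rewrite gtr0_norm.
apply: (oscillating_damping_cvg S active_energy_gt0 (sigma := fun t => f t / 4)
  (C := 2 * il) (phi := fun t => f t * s t * il / 4 - f t * s t * c t * il / 8)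
  (dphi := fun t => b k t ^+ 2 * c t + f t / 4 + g t *
     ((- 2 * b k t ^+ 2 * s t - f t * s t * c t) * il / 4
      - (- 2 * b k t ^+ 2 * s t * c t - f t * s t * c t ^+ 2 + f t * s t ^+ 3) * il / 8))
  rotating_cos2).
- move=> t t0; derive_as; rewrite /=.
  have -> : b k t ^+ 2 = f t * (1 - c t) / 2 := mode_kinetic t0.
  have cs : c t ^+ 2 + s t ^+ 2 = 1 := cos2_sqr t0.
  have eqE : f t / 4 = (c t ^+ 2 + s t ^+ 2) * f t / 4 by rewrite cs mul1r.
  have eqF : f t * c t = (lam k * il) * f t * c t by rewrite ilE mul1r.
  have eqG : f t * c t ^+ 2 = (lam k * il) * f t * c t ^+ 2 by rewrite ilE mul1r.
  have eqH : f t * s t ^+ 2 = (lam k * il) * f t * s t ^+ 2 by rewrite ilE mul1r.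
  by lra.
- by rewrite mulr_ge0// ltW.
- move=> t t0; have cB := cos2_le1 t0; have sB := sin2_le1 t0.
  have fE : f t <= E t := mode_energy_le S k t0.
  have fB : `|f t| <= f t by rewrite ger0_norm// energy_mode_ge0.
  have T1 := norm_mul_le (norm_mul_le fB sB) ilB.
  have T2 := norm_mul_le (norm_mul_le (norm_mul_le fB sB) cB) ilB.
  have P := ler_wpM2l (ltW il0) fE.
  have P0 : 0 <= il * f t := mulr_ge0 (ltW il0) (energy_mode_ge0 (a := a) (b := b) k t).
  move: T1 T2; rewrite -/c -/s !ler_norml => /andP[? ?] /andP[? ?].
  by apply/andP; split; lra.
- move=> t t0; have cB := cos2_le1 t0; have sB := sin2_le1 t0.
  have g0 := damping_ge0 S t0; have f0 : 0 <= f t by exact: energy_mode_ge0.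
  have fB : `|f t| <= f t by rewrite ger0_norm.
  have kB : `|b k t ^+ 2| <= f t by exact: mode_kinetic_le.
  rewrite -/c in cB *; rewrite -/s in sB *.
  have T1 := norm_mul_le (norm_mul_le kB sB) ilB.
  have T2 := norm_mul_le (norm_mul_le (norm_mul_le fB sB) cB) ilB.
  have T3 := norm_mul_le (norm_mul_le (norm_mul_le kB sB) cB) ilB.
  have T4 := norm_mul_le (norm_mul_le (norm_mul_le (norm_mul_le fB sB) cB) cB) ilB.
  have T5 := norm_mul_le (norm_mul_le (norm_mul_le (norm_mul_le fB sB) sB) sB) ilB.
  have P0 := mulr_ge0 (ltW il0) f0.
  rewrite [X in `|X|](_ : _ = g t *
     ((- 2 * b k t ^+ 2 * s t - f t * s t * c t) * il / 4
      - (- 2 * b k t ^+ 2 * s t * c t - f t * s t * c t ^+ 2 + f t * s t ^+ 3) * il / 8));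
    last by ring.
  apply: (@le_trans _ _ (g t * (2 * il * f t))).
    rewrite normrM (ger0_norm g0); apply: ler_wpM2l => //.
    move: T1 T2 T3 T4 T5; rewrite !ler_norml.
    move=> /andP[? ?] /andP[? ?] /andP[? ?] /andP[? ?] /andP[? ?].
    by apply/andP; split; lra.
  rewrite mulrCA -!mulrA ler_pM2l// ler_pM2l//.
  exact: mode_energy_square_le.
- move=> t t0; have f0 : 0 < f t by exact: ek0.
  suff : is_derive t (1 : R) (fun t => ln (f t) + G t + X t / 4)
    (g t * c t + f t / 4) by [].
  have kE : b k t ^+ 2 = f t * (1 - c t) / 2 := mode_kinetic t0.
  by derive_as => //; rewrite kE; field; rewrite gt_eqF.
Qed.

(** Same resonance argument for g sin(2 theta), which has average 0: it drives the
    phase shift. *)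
Lemma phase_shift_cvg (P : R -> R) : has_deriv P (fun t => g t * sin2 t) ->
  exists l : R, P t @[t --> +oo] --> l.
Proof.
move=> dP; have l0 := dm_pos S k.
pose il := (lam k)^-1; have il0 : 0 < il by rewrite invr_gt0.
have ilE : lam k * il = 1 by rewrite mulfV// gt_eqF.
have de := mode_energy_deriv S k; have dc := cos2_deriv; have ds := sin2_deriv.
pose c := cos2; pose s := sin2; pose f t := e t.
rewrite -/c -/s -/f in de dc ds.
have ilB : `|il| <= il by rewrite gtr0_norm.
apply: (oscillating_damping_cvg S active_energy_gt0 (sigma := fun=> 0)
  (C := 2 * il) (phi := fun t => - (f t * c t * il / 4) - f t * s t ^+ 2 * il / 8)
  (dphi := fun t => b k t ^+ 2 * s t + g t *
     ((2 * b k t ^+ 2 * c t - f t * s t ^+ 2) * il / 4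
      + (2 * b k t ^+ 2 * s t ^+ 2 + 2 * f t * s t ^+ 2 * c t) * il / 8))
  (rotating_quarter rotating_cos2)).
- move=> t t0; derive_as; rewrite /=.
  have -> : b k t ^+ 2 = f t * (1 - c t) / 2 := mode_kinetic t0.
  have eqF : f t * s t = (lam k * il) * f t * s t by rewrite ilE mul1r.
  have eqG : f t * c t * s t = (lam k * il) * f t * c t * s t by rewrite ilE mul1r.
  by lra.
- by rewrite mulr_ge0// ltW.
- move=> t t0; have cB := cos2_le1 t0; have sB := sin2_le1 t0.
  have fE : f t <= E t := mode_energy_le S k t0.
  have fB : `|f t| <= f t by rewrite ger0_norm// energy_mode_ge0.
  have T1 := norm_mul_le (norm_mul_le fB cB) ilB.
  have T2 := norm_mul_le (norm_mul_le (norm_mul_le fB sB) sB) ilB.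
  have P' := ler_wpM2l (ltW il0) fE.
  have P0 : 0 <= il * f t := mulr_ge0 (ltW il0) (energy_mode_ge0 (a := a) (b := b) k t).
  move: T1 T2; rewrite -/c -/s !ler_norml => /andP[? ?] /andP[? ?].
  by apply/andP; split; lra.
- move=> t t0; have cB := cos2_le1 t0; have sB := sin2_le1 t0.
  have g0 := damping_ge0 S t0; have f0 : 0 <= f t by exact: energy_mode_ge0.
  have fB : `|f t| <= f t by rewrite ger0_norm.
  have kB : `|b k t ^+ 2| <= f t by exact: mode_kinetic_le.
  rewrite -/c in cB *; rewrite -/s in sB *.
  have T1 := norm_mul_le (norm_mul_le kB cB) ilB.
  have T2 := norm_mul_le (norm_mul_le (norm_mul_le fB sB) sB) ilB.
  have T3 := norm_mul_le (norm_mul_le (norm_mul_le kB sB) sB) ilB.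
  have T4 := norm_mul_le (norm_mul_le (norm_mul_le (norm_mul_le fB sB) sB) cB) ilB.
  have P0 := mulr_ge0 (ltW il0) f0.
  rewrite [X in `|X|](_ : _ = g t *
     ((2 * b k t ^+ 2 * c t - f t * s t ^+ 2) * il / 4
      + (2 * b k t ^+ 2 * s t ^+ 2 + 2 * f t * s t ^+ 2 * c t) * il / 8));
    last by ring.
  apply: (@le_trans _ _ (g t * (2 * il * f t))).
    rewrite normrM (ger0_norm g0); apply: ler_wpM2l => //.
    move: T1 T2 T3 T4; rewrite !ler_norml.
    move=> /andP[? ?] /andP[? ?] /andP[? ?] /andP[? ?].
    by apply/andP; split; lra.
  rewrite mulrCA -!mulrA ler_pM2l// ler_pM2l//.
  exact: mode_energy_square_le.
- by move=> t t0; apply: is_derive_eq (dP t t0) _; rewrite addr0.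
Qed.

End ActiveMode.

(** * The common growth rate *)

Section GrowthRate.
Context {R : realType} {lam : nat -> R} {a b : nat -> R -> R} {g E : R -> R}.
Context (S : damped_modes lam a b g E).
Context {G M : R -> R} (dG : has_deriv G g).
Context (dM : has_deriv M (fun t => expR (- G t))).
Context (M_ge1 : forall t, 1 <= t -> 1 <= M t).

Local Notation en i t := (a i t ^+ 2 + b i t ^+ 2).

Lemma growth_pos t : 1 <= t -> 0 < M t.
Proof. by move=> /M_ge1; apply: lt_le_trans. Qed.

Lemma growth_nondecreasing s t : 1 <= s -> s <= t -> M s <= M t.
Proof.
move=> s1; apply: (deriv_ge0_nondecreasing dM); last by lra.
by move=> x _; exact: expR_ge0.
Qed.

Section OneMode.
Context (k : nat) (ek0 : forall t, 0 < t -> 0 < a k t ^+ 2 + b k t ^+ 2).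
Context {X : R -> R} (dX : has_deriv X (fun t => a k t ^+ 2 + b k t ^+ 2)).

Local Notation e t := (a k t ^+ 2 + b k t ^+ 2).

(** The combination of [log_energy_cvg], exponentiated: this makes the
    differential relation between X_k and G integrable. *)
Lemma exp_primitive_deriv : has_deriv (fun t => expR (X t / 4))
  (fun t => expR (ln (e t) + G t + X t / 4) / 4 * expR (- G t)).
Proof.
move=> t t0; derive_as.
have E1 : expR (G t) * expR (- G t) = 1 by rewrite -expRD subrr expR0.
rewrite !expRD lnK ?posrE ?ek0//.
apply: (@eq_trans _ _ ((expR (G t) * expR (- G t)) * (e t * expR (X t / 4) / 4))); last by ring.
by rewrite E1; field.
Qed.

Lemma mode_primitive_nondecreasing s t : 0 < s -> s <= t -> X s <= X t.
Proof.
by apply: (deriv_ge0_nondecreasing dX) => x _; exact: energy_mode_ge0.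
Qed.

(** exp(X_k / 4) has derivative c_k M' (1 + o(1)): up to the constant c_k, all
    active modes obey the same equation, and so they have the same profile. *)
Lemma mode_profile : M t @[t --> +oo] --> +oo ->
  (exists l : R, X t / 2 - 2 * ln (M t) @[t --> +oo] --> l) /\
  e t * (M t * expR (G t)) @[t --> +oo] --> (4 : R).
Proof.
move=> Minf; have [l Hl] := log_energy_cvg S ek0 dG dX.
have expL := cvg_expR Hl.
have phil : expR (ln (e t) + G t + X t / 4) / 4 @[t --> +oo] --> expR l / 4.
  by apply: cvgM => //; exact: cvg_cst.
have el0 : 0 < expR l / 4 by rewrite divr_gt0// expR_gt0.
have ratio : expR (X t / 4) / M t @[t --> +oo] --> expR l / 4.
  by apply: (cvg_quotient_of_derivatives exp_primitive_deriv dM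
    (phi := fun t => expR (ln (e t) + G t + X t / 4) / 4)).
split.
- exists (2 * ln (expR l / 4)).
  have c : 2 * ln (expR (X t / 4) / M t) @[t --> +oo] --> 2 * ln (expR l / 4).
    by apply: cvgMr; exact: cvg_ln.
  apply: cvg_trans c; apply: near_eq_cvg; near=> t.
  have Mt : 0 < M t by apply: growth_pos; near: t; exact: nbhs_pinfty_ge.
  by rewrite ln_div ?posrE ?expR_gt0// expRK; field.
- have c : expR (ln (e t) + G t + X t / 4) * (expR (X t / 4) / M t)^-1 @[t --> +oo]
      --> expR l * (expR l / 4)^-1.
    by apply: cvgM => //; apply: cvgV => //; rewrite gt_eqF.
  have E4 : expR l * (expR l / 4)^-1 = 4 by field; rewrite gt_eqF ?expR_gt0.
  rewrite E4 in c; apply: cvg_trans c; apply: near_eq_cvg; near=> t.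
  have t0 : 0 < t by near: t; exact: nbhs_pinfty_gt.
  have Mt : 0 < M t by apply: growth_pos; near: t; exact: nbhs_pinfty_ge.
  rewrite !expRD lnK ?posrE ?ek0//; field.
  by rewrite gt_eqF ?gt_eqF ?expR_gt0.
Unshelve. all: by end_near. Qed.

(** (exp(X_k / 4))' is at most a constant times M'. *)
Lemma bounded_growth_bounds_mode (B : R) : (forall t, 1 <= t -> M t <= B) ->
  exists C : R, forall t, 1 <= t -> X t <= C.
Proof.
move=> MB; have [l Hl] := log_energy_cvg S ek0 dG dX.
have [T0 [_ HT0]] : \forall t \near +oo, ln (e t) + G t + X t / 4 <= l + 1.
  by apply: (cvgr_le _ Hl); rewrite ltrDl.
pose T := Num.max T0 1 + 1.
have T1 : 1 <= T by rewrite ler_wpDr// le_max lexx orbT.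
have T0T : T0 < T by rewrite (@le_lt_trans _ _ (Num.max T0 1))// ?ltrDl// le_max lexx.
pose K := expR (l + 1).
have dKM : has_deriv (fun t => K * M t) (fun t => K * expR (- G t)).
  by move=> t t0; derive_as; ring.
have bound t : T <= t -> expR (X t / 4) <= expR (X T / 4) + K * (B - M T).
  move=> Tt.
  have H x : T <= x <= t -> expR (ln (e x) + G x + X x / 4) / 4 * expR (- G x)
      <= K * expR (- G x).
    move=> /andP[Tx _]; rewrite ler_pM2r ?expR_gt0//.
    have : expR (ln (e x) + G x + X x / 4) <= K.
      by rewrite ler_expR; apply: HT0; exact: lt_le_trans Tx.
    have := expR_ge0 (ln (e x) + G x + X x / 4); lra.
  have := increment_le exp_primitive_deriv dKM H (lt_le_trans ltr01 T1) Tt.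
  have : K * M t <= K * B by rewrite ler_pM2l ?expR_gt0// MB//; exact: le_trans Tt.
  by lra.
pose D := expR (X T / 4) + K * (B - M T).
exists (4 * ln D) => t t1.
pose t' := Num.max t T.
have Tt' : T <= t' by rewrite le_max lexx orbT.
have tt' : t <= t' by rewrite le_max lexx.
have D0 : 0 < D by apply: lt_le_trans (bound _ Tt'); exact: expR_gt0.
apply: (@le_trans _ _ (X t')).
  by apply: mode_primitive_nondecreasing tt'; lra.
suff : X t' / 4 <= ln D by lra.
by rewrite -ler_expR lnK ?posrE//; exact: bound.
Qed.

End OneMode.

(** By [mode_profile] X_k is 4 ln M + const + o(1), and V is half of X_k on
    average. *)
Lemma kinetic_profile k (V : R -> R) :
  (forall t, 0 < t -> 0 < a k t ^+ 2 + b k t ^+ 2) ->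
  has_deriv V (fun t => b k t ^+ 2) -> M t @[t --> +oo] --> +oo ->
  exists l : R, V t - 2 * ln (M t) @[t --> +oo] --> l.
Proof.
move=> ek0 dV Minf.
have [X dX] : exists X : R -> R, has_deriv X (fun t => en k t).
  by apply: primitive_exists => t; exact: has_deriv_continuous (mode_energy_deriv S k).
have [[l1 H1] _] := mode_profile ek0 dX Minf.
have [l2 H2] := kinetic_half_cvg S (active_energy_gt0 S ek0) dV dX.
exists (l2 + l1).
suff -> : (fun t => V t - 2 * ln (M t)) =
    (fun t => (V t - X t / 2) + (X t / 2 - 2 * ln (M t))) by exact: cvgD H2 H1.
by apply/funext => t; ring.
Qed.

End GrowthRate.

(** * Decay rates of the modes *)

Section Rates.
Context {R : realType} {lam : nat -> R} {a b : nat -> R -> R} {g E : R -> R}.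
Context (S : damped_modes lam a b g E).

Local Notation en i t := (a i t ^+ 2 + b i t ^+ 2).

(** The constant in M is chosen so that ln M makes sense. *)
Lemma growth_exists : exists G M : R -> R,
  [/\ has_deriv G g, has_deriv M (fun t => expR (- G t)) &
      forall t, 1 <= t -> 1 <= M t].
Proof.
have [G dG] := primitive_exists (dm_gc S).
have dF : has_deriv (fun t => expR (- G t)) (fun t => expR (- G t) * - g t).
  by move=> t t0; derive_as.
have [M dM] := primitive_exists (fun t => has_deriv_continuous dF (t := t)).
exists G, (fun t => M t + (1 - M 1)); split => //.
  by move=> t t0; derive_as; rewrite addr0.
move=> t t1.
have := deriv_ge0_nondecreasing dM (fun x _ => expR_ge0 (- G x)) ltr01 t1; lra.
Qed.

Lemma mode_primitive k : exists X : R -> R, has_deriv X (fun t => en k t).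
Proof.
apply: primitive_exists => t.
exact: has_deriv_continuous (mode_energy_deriv S k).
Qed.

(** Sum of [kinetic_profile] over the active modes; the primitives of the other
    modes are constant. *)
Lemma partial_damping_profile (act : pred nat) (V : nat -> R -> R) (G M : R -> R) n :
  has_deriv G g -> has_deriv M (fun t => expR (- G t)) ->
  (forall t, 1 <= t -> 1 <= M t) -> M t @[t --> +oo] --> +oo ->
  (forall i, act i -> forall t, 0 < t -> 0 < en i t) ->
  (forall i, ~~ act i -> forall t, 0 < t -> a i t = 0 /\ b i t = 0) ->
  (forall i, has_deriv (V i) (fun t => b i t ^+ 2)) ->
  exists l : R, \sum_(i < n) V i t - 2 * (\sum_(i < n) act i)%N%:R * ln (M t)
    @[t --> +oo] --> l.
Proof.
move=> dG dM M1 Minf actP inactP dV.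
have [i ni|l Hl] := @cvg_sum _ n (fun i t => V i t - (act i)%:R * (2 * ln (M t))).
  have [ai|ai] := boolP (act i).
    have [l Hl] := kinetic_profile S dG dM M1 (actP i ai) (dV i) Minf.
    by exists l; under eq_fun do rewrite mul1r.
  exists (V i 1); under eq_fun do rewrite mul0r subr0.
  apply/cvgrPdist_le => e e0; near=> t.
  have t1 : 1 <= t by near: t; exact: nbhs_pinfty_ge.
  rewrite (deriv0_constant (dV i) _ ltr01 t1) ?subrr ?normr0 ?ltW// => x /andP[x1 _].
  by have [_ ->] := inactP i ai x (lt_le_trans ltr01 x1); rewrite expr0n.
exists l; suff -> : (fun t => \sum_(i < n) V i t - 2 * (\sum_(i < n) act i)%N%:R * ln (M t)) =
    (fun t => \sum_(i < n) (V i t - (act i)%:R * (2 * ln (M t)))) by [].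
by apply/funext => t; rewrite sumrB -mulr_suml natr_sum; ring.
Unshelve. all: by end_near. Qed.

(** With j active modes, G = 2 j ln M + const + o(1), so that M' M^(2j) has a positive
    limit: this is a closed equation for M. *)
Lemma finite_modes_rate (act : pred nat) (N j k : nat) :
  (forall i, act i -> forall t, 0 < t -> 0 < en i t) ->
  (forall i, ~~ act i -> forall t, 0 < t -> a i t = 0 /\ b i t = 0) ->
  (forall i, act i -> (i < N)%N) -> (\sum_(i < N) act i)%N = j -> act k ->
  t * en k t @[t --> +oo] --> (4 / (2 * j%:R + 1) : R).
Proof.
move=> actP inactP actN jE actk.
have [G [M [dG dM M1]]] := growth_exists.
have [V dV] := kinetic_primitives S.
have dVN : has_deriv (fun t => \sum_(i < N) V i t) (fun t => \sum_(i < N) b i t ^+ 2).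
  by move=> x x0; apply: (is_derive_fsum (F := V) (dF := fun i t => b i t ^+ 2)) => i _; exact: dV.
have gE t : 0 < t -> g t = \sum_(i < N) b i t ^+ 2.
  move=> t0; suff c : \sum_(i < n) b i t ^+ 2 @[n --> \oo] --> \sum_(i < N) b i t ^+ 2.
    by apply: cvg_unique (dm_g S t0) c.
  apply: (stationary_sums_cvg (u := fun i => b i t ^+ 2)) => i Ni.
  have ai : ~~ act i by apply/negP => /actN; rewrite ltnNge Ni.
  by have [_ ->] := inactP i ai t t0; rewrite expr0n.
have dGV : has_deriv (fun t => G t - \sum_(i < N) V i t)
    (fun t => g t - \sum_(i < N) b i t ^+ 2).
  by move=> t t0; apply: is_derive_fD; [exact: dG|apply: is_derive_fN; exact: dVN].
have [X dX] := mode_primitive k.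
have [|[B MB]] := nondecreasing_dichotomy (growth_nondecreasing dM); last first.
  (* if M were bounded, so would be all V_i and G, hence M' would be bounded below *)
  have VB i : exists C : R, forall t, 1 <= t -> V i t <= C.
    have [ai|ai] := boolP (act i); last first.
      exists (V i 1) => t t1; rewrite (deriv0_constant (dV i) _ ltr01 t1)// => x /andP[x1 _].
      by have [_ ->] := inactP i ai x (lt_le_trans ltr01 x1); rewrite expr0n.
    have [Xi dXi] := mode_primitive i.
    have [C XC] := bounded_growth_bounds_mode S dG dM (actP i ai) dXi MB.
    exists (V i 1 + (C - Xi 1)) => t t1.
    have H x : 1 <= x <= t -> b i x ^+ 2 <= en i x.
      by move=> _; have := sqr_ge0 (a i x); lra.
    have := increment_le (dV i) dXi H ltr01 t1; have := XC t t1; lra.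
  have /choice[C VC] := VB.
  have GC t : 1 <= t -> G t <= (G 1 - \sum_(i < N) V i 1) + \sum_(i < N) C i.
    move=> t1.
    have : G t - \sum_(i < N) V i t = G 1 - \sum_(i < N) V i 1.
      apply: (deriv0_constant dGV) => // x /andP[x1 _].
      by rewrite gE ?subrr//; lra.
    have : \sum_(i < N) V i t <= \sum_(i < N) C i by apply: ler_sum => i _; exact: VC.
    by lra.
  set D := _ + _ in GC.
  have lin : has_deriv (fun t : R => expR (- D) * t) (fun=> expR (- D)).
    by move=> t t0; derive_as; ring.
  pose t := 1 + `|B| / expR (- D).
  have eD := expR_gt0 (- D).
  have t1 : 1 <= t by rewrite lerDl divr_ge0// ltW.
  have H x : 1 <= x <= t -> expR (- D) <= expR (- G x).
    by move=> /andP[x1 _]; rewrite ler_expR lerN2 GC.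
  have := increment_le lin dM H ltr01 t1; have := MB t t1; have := M1 1 (lexx 1).
  have -> : expR (- D) * t = expR (- D) + `|B| by rewrite /t; field; rewrite gt_eqF.
  by have := ler_norm B; lra.
move=> Minf.
have [l Hl] := partial_damping_profile N dG dM M1 Minf actP inactP dV.
rewrite jE in Hl.
pose P t := M t ^+ (2 * j) * expR (- G t).
have [K K0 PK] : exists2 K : R, 0 < K & P t @[t --> +oo] --> K.
  pose D := G 1 - \sum_(i < N) V i 1.
  exists (expR (- l - D)); first exact: expR_gt0.
  have c : expR (- (\sum_(i < N) V i t - 2 * j%:R * ln (M t)) - D) @[t --> +oo] --> expR (- l - D).
    by apply: cvg_expR; apply: cvgB; [exact: cvgN|exact: cvg_cst].
  apply: cvg_trans c; apply: near_eq_cvg; near=> t.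
  have t1 : 1 <= t by near: t; exact: nbhs_pinfty_ge.
  have Mt := growth_pos M1 t1.
  have GE : G t = \sum_(i < N) V i t + D.
    have : G t - \sum_(i < N) V i t = D; last by lra.
    apply: (deriv0_constant dGV) => // x /andP[x1 _].
    by rewrite gE ?subrr//; lra.
  rewrite /P GE -{2}(@lnK _ (M t)) ?posrE// -expRM_natl -expRD; congr expR.
  by rewrite natrM; ring.
have [_ ekM] := mode_profile S dG dM M1 (actP k actk) dX Minf.
have dMp : has_deriv (fun t => M t ^+ (2 * j).+1)
    (fun t => (2 * j).+1%:R * P t).
  by move=> t t0; derive_as; rewrite /P mulrA.
have did : has_deriv (fun t : R => t) (fun=> 1) by move=> t t0; exact: is_derive_fid.
have cMp : M t ^+ (2 * j).+1 / t @[t --> +oo] --> (2 * j).+1%:R * K.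
  apply: (cvg_quotient_of_derivatives dMp did
    (phi := fun t => (2 * j).+1%:R * P t)).
  - by move=> *; exact: ler01.
  - by move=> t _; rewrite mulr1.
  - exact: cvgMr.
  - exact: cvg_id.
have j1E : (2 * j).+1%:R = 2 * j%:R + 1 :> R by rewrite -natr1 natrM.
have j10 : 0 < (2 * j).+1%:R :> R by [].
have c : en k t * (M t * expR (G t)) * (M t ^+ (2 * j).+1 / t)^-1 * P t @[t --> +oo]
    --> 4 * ((2 * j).+1%:R * K)^-1 * K.
  apply: cvgM => //; apply: cvgM => //; apply: cvgV => //.
  by rewrite mulf_neq0 ?gt_eqF.
have limE : 4 * ((2 * j).+1%:R * K)^-1 * K = 4 / (2 * j%:R + 1).
  by rewrite j1E; field; rewrite -j1E !gt_eqF.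
rewrite limE in c; apply: cvg_trans c; apply: near_eq_cvg; near=> t.
have t1 : 1 <= t by near: t; exact: nbhs_pinfty_ge.
have Mt := growth_pos M1 t1; have Gt := expR_gt0 (G t).
have GE : expR (G t) * expR (- G t) = 1 by rewrite -expRD subrr expR0.
rewrite /P (exprS (M t) (2 * j)); set Y := M t ^+ (2 * j).
have Y0 : Y != 0 by rewrite expf_neq0// gt_eqF.
suff -> : t * en k t = en k t * t * (expR (G t) * expR (- G t)).
  by field; rewrite Y0 !gt_eqF//; lra.
by rewrite GE; ring.
Unshelve. all: by end_near. Qed.

(** For every n, M^(2n) M' is a convergent function times a nonincreasing one, so
    that M^(2n+1) is at least (2n+1) t M^(2n) M' / 4 for large t: each additional active
    mode makes t M' / M smaller. *)
Lemma infinite_modes_rate (act : pred nat) k :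
  (forall i, act i -> forall t, 0 < t -> 0 < en i t) ->
  (forall i, ~~ act i -> forall t, 0 < t -> a i t = 0 /\ b i t = 0) ->
  (forall n, exists N, (n <= \sum_(i < N) act i)%N) -> act k ->
  t * en k t @[t --> +oo] --> (0 : R).
Proof.
move=> actP inactP actinf actk.
have [G [M [dG dM M1]]] := growth_exists.
have [V dV] := kinetic_primitives S.
have [X dX] := mode_primitive k.
have [|[B MB]] := nondecreasing_dichotomy (growth_nondecreasing dM); last first.
  (* e_k is nonincreasing with bounded integral *)
  have [C XC] := bounded_growth_bounds_mode S dG dM (actP k actk) dX MB.
  have Xm s t : 1 <= s -> s <= t -> X s <= X t.
    by move=> s1; apply: (mode_primitive_nondecreasing dX); lra.
  have [q [Xq Xle]] := nondecreasing_bounded_cvg Xm XC.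
  have half : X (t / 2) @[t --> +oo] --> q.
    apply: (cvg_comp (fun t => t / 2) X _ Xq).
    by apply: gt0_cvgMly; [rewrite invr_gt0|exact: cvg_id].
  apply: (squeeze_cvgr (f := fun=> 0) (h := fun t => 2 * (q - X (t / 2)))).
  - near=> t; have t2 : 2 <= t by near: t; exact: nbhs_pinfty_ge.
    apply/andP; split; first by rewrite mulr_ge0 ?energy_mode_ge0//; lra.
    have dek : has_deriv (fun s => en k t * s) (fun=> en k t).
      by move=> s s0; derive_as; ring.
    have H x : t / 2 <= x <= t -> en k t <= en k x.
      move=> /andP[tx xt]; have x0 : 0 < x by lra.
      apply: (deriv_le0_nonincreasing (mode_energy_deriv S k)) xt => // y /andP[xy _].
      have := damping_ge0 S (lt_le_trans x0 xy); have := sqr_ge0 (b k y); nra.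
    have ht : t / 2 <= t by lra.
    have h0 : 0 < t / 2 by lra.
    have t1 : 1 <= t by lra.
    have := increment_le dek dX H h0 ht; have := Xle t t1; lra.
  - exact: cvg_cst.
  - rewrite -[X in _ --> X](mulr0 2) -[X in _ * X](subrr q).
    by apply: cvgMr; apply: cvgB => //; exact: cvg_cst.
move=> Minf.
have [_ ekM] := mode_profile S dG dM M1 (actP k actk) dX Minf.
have ekM5 : \forall t \near +oo, en k t * (M t * expR (G t)) <= 5.
  by apply: (cvgr_le _ ekM); rewrite ltr_nat.
have key n : (0 < n)%N -> \forall t \near +oo, t * en k t <= 10 / n%:R.
  move=> n0; have [N Nn] := actinf n.
  set j := (\sum_(i < N) act i)%N in Nn.
  have [l Hl] := partial_damping_profile N dG dM M1 Minf actP inactP dV.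
  rewrite -/j in Hl.
  pose rho t := expR (- (\sum_(i < N) V i t - 2 * j%:R * ln (M t))).
  have rhol : rho t @[t --> +oo] --> expR (- l) by apply: cvg_expR; exact: cvgN.
  have el := expR_gt0 (- l).
  have rho_lo : \forall t \near +oo, expR (- l) * (3 / 4) <= rho t.
    by apply: (cvgr_ge _ rhol); lra.
  have rho_hi : \forall t \near +oo, rho t <= expR (- l) * (3 / 2).
    by apply: (cvgr_le _ rhol); lra.
  have [T0 [_ HT0]] : \forall t \near +oo, expR (- l) * (3 / 4) <= rho t <= expR (- l) * (3 / 2).
    by near=> t; apply/andP; split; near: t.
  pose T := Num.max T0 1 + 1.
  have T1 : 1 <= T by rewrite ler_wpDr// le_max lexx orbT.
  have T0T : T0 < T by rewrite (@le_lt_trans _ _ (Num.max T0 1))// ?ltrDl// le_max lexx.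
  pose P t := M t ^+ (2 * j) * expR (- G t).
  have PE t : 1 <= t -> P t = rho t * expR (- (G t - \sum_(i < N) V i t)).
    move=> t1; have Mt := growth_pos M1 t1.
    rewrite /P /rho -{1}(@lnK _ (M t)) ?posrE// -expRM_natl -!expRD; congr expR.
    by rewrite natrM; ring.
  have dGV : has_deriv (fun t => G t - \sum_(i < N) V i t)
      (fun t => g t - \sum_(i < N) b i t ^+ 2).
    move=> x x0; apply: is_derive_fD; first exact: dG.
    apply: is_derive_fN.
    by apply: (is_derive_fsum (F := V) (dF := fun i t => b i t ^+ 2)) => i _; exact: dV.
  have Plow s t : T <= s -> s <= t -> P t / 2 <= P s.
    move=> Ts st; have s1 : 1 <= s by lra.
    have t1 : 1 <= t by lra.
    rewrite !PE//.
    have /andP[_ hi] := HT0 t (lt_le_trans T0T (le_trans Ts st)).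
    have /andP[lo _] := HT0 s (lt_le_trans T0T Ts).
    have dec : expR (- (G t - \sum_(i < N) V i t)) <= expR (- (G s - \sum_(i < N) V i s)).
      rewrite ler_expR lerN2; apply: (deriv_ge0_nondecreasing dGV) st; last by lra.
      by move=> x /andP[sx _]; apply: (partial_damping_tail_ge0 S); lra.
    rewrite mulrAC; apply: ler_pM => //; last by lra.
    by rewrite divr_ge0// expR_ge0.
  have dMp : has_deriv (fun t => M t ^+ (2 * j).+1) (fun t => (2 * j).+1%:R * P t).
    by move=> t t0; derive_as; rewrite /P mulrA.
  near=> t.
  have T2t : 2 * T <= t by near: t; apply: nbhs_pinfty_ge; exact: num_real.
  have Tt : T <= t by lra.
  have t1 : 1 <= t by lra.
  have Mt := growth_pos M1 t1; have Gt := expR_gt0 (G t).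
  have Pt : 0 <= P t by rewrite mulr_ge0 ?exprn_ge0 ?expR_ge0 ?ltW.
  have dlin : has_deriv (fun s : R => (2 * j).+1%:R * (P t / 2) * s)
      (fun=> (2 * j).+1%:R * (P t / 2)).
    by move=> s s0; derive_as; ring.
  have H x : T <= x <= t -> (2 * j).+1%:R * (P t / 2) <= (2 * j).+1%:R * P x.
    by move=> /andP[Tx xt]; rewrite ler_pM2l//; exact: Plow.
  have incr := increment_le dlin dMp H (lt_le_trans ltr01 T1) Tt.
  have MT : 0 <= M T ^+ (2 * j).+1 by rewrite exprn_ge0// ltW// (growth_pos M1).
  have lowM : (2 * j).+1%:R * P t * t <= 4 * M t ^+ (2 * j).+1.
    have : (2 * j).+1%:R * (P t / 2) * (t / 2) <= (2 * j).+1%:R * (P t / 2) * (t - T).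
      by apply: ler_wpM2l; [rewrite mulr_ge0// divr_ge0|lra].
    by lra.
  have ek5 : en k t * (M t * expR (G t)) <= 5 by near: t.
  have GE : expR (G t) * expR (- G t) = 1 by rewrite -expRD subrr expR0.
  have lowM' : (2 * j).+1%:R * t * expR (- G t) <= 4 * M t.
    rewrite -(ler_pM2r (exprn_gt0 (2 * j) Mt)).
    by move: lowM; rewrite /P (exprS (M t) (2 * j)); lra.
  rewrite ler_pdivlMr ?ltr0n//.
  have jn : n%:R * 2 <= (2 * j).+1%:R :> R.
    by rewrite -natrM ler_nat mulnC; apply/leqW; rewrite leq_mul2l.
  have e0 : 0 <= t * en k t by rewrite mulr_ge0 ?energy_mode_ge0//; lra.
  have : t * en k t * (2 * j).+1%:R <= 20.
    have -> : t * en k t * (2 * j).+1%:R =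
      en k t * expR (G t) * ((2 * j).+1%:R * t * expR (- G t)).
      rewrite [RHS](_ : _ = t * en k t * (2 * j).+1%:R * (expR (G t) * expR (- G t))).
        by rewrite GE mulr1.
      by ring.
    have : en k t * expR (G t) * ((2 * j).+1%:R * t * expR (- G t)) <=
        en k t * expR (G t) * (4 * M t).
      by apply: ler_wpM2l => //; rewrite mulr_ge0 ?energy_mode_ge0// ltW.
    by lra.
  have := ler_wpM2l e0 jn; lra.
apply/cvgrPdist_le => e e0.
pose n := (Num.bound (10 / e)).+1.
have nE : 10 / n%:R <= e.
  rewrite ler_pdivrMr ?ltr0n// mulrC -ler_pdivrMr//.
  have := archi_boundP (divr_ge0 (ler0n R 10) (ltW e0)).
  by move=> /ltW h; apply: (le_trans h); rewrite ler_nat.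
near=> t.
have t0 : 0 < t by near: t; exact: nbhs_pinfty_gt.
have tn : t * en k t <= 10 / n%:R by near: t; exact: key.
have te : 0 <= t * en k t by apply: mulr_ge0; [exact: ltW|exact: energy_mode_ge0].
by rewrite sub0r normrN (ger0_norm te); exact: le_trans nE.
Unshelve. all: by end_near. Qed.

End Rates.

(** * Phases *)

Section PolarForm.
Context {R : realType} {lam : nat -> R} {a b : nat -> R -> R} {g E : R -> R}.
Context (S : damped_modes lam a b g E) (k : nat).
Context (ek0 : forall t, 0 < t -> 0 < a k t ^+ 2 + b k t ^+ 2).

Local Notation e t := (a k t ^+ 2 + b k t ^+ 2).

Lemma unit_circle_angle (x y : R) : x ^+ 2 + y ^+ 2 = 1 ->
  exists w : R, cos w = x /\ sin w = y.
Proof.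
move=> xy; have x1 : -1 <= x <= 1.
  rewrite -ler_norml -(expr_le1 (n := 2))// real_normK ?num_real//.
  by have := sqr_ge0 y; lra.
have yE : Num.sqrt (1 - x ^+ 2) = `|y| by rewrite -sqrtr_sqr; congr Num.sqrt; lra.
have [y0|y0] := leP 0 y.
  exists (acos x); rewrite acosK ?in_itv//= sin_acos// yE ger0_norm//.
exists (- acos x); rewrite cosN sinN acosK ?in_itv//= sin_acos// yE ltr0_norm//.
by rewrite opprK.
Qed.

(** In the frame rotating with theta the normalized state is constant; the angle
    theta differs from lambda_k t by a convergent function. *)
Lemma polar_asymptotics (r : R) : 0 <= r -> t * e t @[t --> +oo] --> r ^+ 2 ->
  exists theta : R,
    Num.sqrt t * a k t - r * cos (lam k * t + theta) @[t --> +oo] --> (0 : R) /\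
    Num.sqrt t * b k t + r * sin (lam k * t + theta) @[t --> +oo] --> (0 : R).
Proof.
move=> r0 te.
have de := mode_energy_deriv S k; have Da := dm_a S k; have Db := dm_b S k.
have dsg : forall t, 0 < t -> {for t, continuous (fun t => g t * sin2 (a := a) (b := b) k t)}.
  move=> t t0; apply: cvgM; first exact: (dm_gc S).
  exact: (has_deriv_continuous (sin2_deriv S ek0)).
have [P dP] := primitive_exists dsg.
have [p Pp] := phase_shift_cvg S ek0 dP.
pose Th t := lam k * t - P t / 2.
have dTh : has_deriv Th (fun t => lam k - g t * sin2 (a := a) (b := b) k t / 2).
  by rewrite /Th => t t0; derive_as; ring.
pose f t := e t; have f0 t : 0 < t -> 0 < f t := ek0 (t := t).
have df : has_deriv f (fun t => - 2 * g t * b k t ^+ 2) := de.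
pose h t := expR (- (ln (f t) / 2)).
have h0 t : 0 < h t by exact: expR_gt0.
have dh : has_deriv h (fun t => h t * (g t * b k t ^+ 2 / f t)).
  rewrite /h => t t0; derive_as; first exact: f0.
  by field; rewrite gt_eqF// f0.
have hf t : 0 < t -> h t ^+ 2 * f t = 1.
  move=> t0; rewrite /h -expRM_natl -[X in _ * X](lnK (_ : f t \is Num.pos)) ?posrE ?f0//.
  by rewrite -expRD -[RHS](expR0 R); congr expR; field.
have hE t : 0 < t -> Num.sqrt (f t) = (h t)^-1.
  move=> t0; have -> : f t = (h t)^-1 ^+ 2.
    have h2 : h t ^+ 2 != 0 by rewrite expf_neq0// gt_eqF.
    by apply: (mulfI h2); rewrite hf// exprVn mulfV.
  by rewrite sqrtr_sqr gtr0_norm// invr_gt0.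
have s2E t : 0 < t -> sin2 (a := a) (b := b) k t = - (2 * a k t * b k t) / f t by [].
pose A t := (a k t * cos (Th t) - b k t * sin (Th t)) * h t.
pose B t := (a k t * sin (Th t) + b k t * cos (Th t)) * h t.
have fE t : f t = a k t ^+ 2 + b k t ^+ 2 by [].
have dA : has_deriv A (fun=> 0).
  rewrite /A => t t0; derive_as; rewrite s2E//.
  have := f0 t t0; rewrite fE => ft; field.
  by rewrite gt_eqF.
have dB : has_deriv B (fun=> 0).
  rewrite /B => t t0; derive_as; rewrite s2E//.
  have := f0 t t0; rewrite fE => ft; field.
  by rewrite gt_eqF.
have AE t : 1 <= t -> A t = A 1 by move=> t1; exact: (deriv0_constant dA).
have BE t : 1 <= t -> B t = B 1 by move=> t1; exact: (deriv0_constant dB).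
have [w [cw sw]] : exists w : R, cos w = A 1 /\ sin w = B 1.
  apply: unit_circle_angle.
  rewrite /A /B.
  have h1 := hf 1 ltr01; have := cos2Dsin2 (Th 1); rewrite fE in h1.
  set c := cos _; set s := sin _ => cs.
  apply: (@eq_trans _ _ ((c ^+ 2 + s ^+ 2) * (h 1 ^+ 2 * (a k 1 ^+ 2 + b k 1 ^+ 2)))).
    by ring.
  by rewrite cs h1 mul1r.
have aE t : 1 <= t -> a k t = Num.sqrt (f t) * cos (Th t - w).
  move=> t1; have t0 : 0 < t by lra.
  rewrite hE// cosB cw sw -(AE t t1) -(BE t t1) /A /B.
  have := cos2Dsin2 (Th t); set c := cos _; set s := sin _ => cs.
  apply: (@eq_trans _ _ ((c ^+ 2 + s ^+ 2) * a k t)); first by rewrite cs mul1r.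
  by field; rewrite gt_eqF.
have bE t : 1 <= t -> b k t = - (Num.sqrt (f t) * sin (Th t - w)).
  move=> t1; have t0 : 0 < t by lra.
  rewrite hE// sinB cw sw -(AE t t1) -(BE t t1) /A /B.
  have := cos2Dsin2 (Th t); set c := cos _; set s := sin _ => cs.
  apply: (@eq_trans _ _ ((c ^+ 2 + s ^+ 2) * b k t)); first by rewrite cs mul1r.
  by field; rewrite gt_eqF.
pose theta := - p / 2 - w; exists theta.
pose d t := (p - P t) / 2; pose q t := Num.sqrt (t * f t).
have ThE t : Th t - w = lam k * t + theta + d t by rewrite /Th /theta /d; field.
have d0 : d t @[t --> +oo] --> (0 : R).
  have c : (p - P t) / 2 @[t --> +oo] --> ((p - p) / 2 : R).
    by apply: cvgMl; apply: cvgB => //; exact: cvg_cst.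
  by rewrite subrr mul0r in c.
have qr : q t @[t --> +oo] --> r.
  have -> : r = Num.sqrt (r ^+ 2) by rewrite sqrtr_sqr ger0_norm.
  by apply: continuous_cvg te; exact: sqrt_continuous.
have cosd : cos (d t) @[t --> +oo] --> (1 : R).
  by rewrite -(cos0 R); apply: continuous_cvg d0; exact: continuous_cos.
have sind : sin (d t) @[t --> +oo] --> (0 : R).
  by rewrite -(sin0 R); apply: continuous_cvg d0; exact: continuous_sin.
have qc : q t * cos (d t) - r @[t --> +oo] --> (0 : R).
  have c : q t * cos (d t) - r @[t --> +oo] --> (r * 1 - r : R).
    by apply: cvgB; [exact: cvgM|exact: cvg_cst].
  by rewrite mulr1 subrr in c.
have qs : q t * sin (d t) @[t --> +oo] --> (0 : R).
  by rewrite -[X in _ --> X](mulr0 r); exact: cvgM.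
pose x t := lam k * t + theta.
have bc t : `|cos (x t)| <= 1 by rewrite ler_norml cos_geN1 cos_le1.
have bs t : `|sin (x t)| <= 1 by rewrite ler_norml sin_geN1 sin_le1.
have sqE t : 0 < t -> Num.sqrt t * Num.sqrt (f t) = q t.
  by move=> t0; rewrite /q sqrtrM// ltW.
split.
- have c : (q t * cos (d t) - r) * cos (x t) - q t * sin (d t) * sin (x t)
      @[t --> +oo] --> (0 - 0 : R).
    by apply: cvgB; apply: cvg0_mul_bounded.
  rewrite subrr in c.
  apply: cvg_trans c; apply: near_eq_cvg; near=> t.
  have t1 : 1 <= t by near: t; exact: nbhs_pinfty_ge.
  have t0 : 0 < t by lra.
  by rewrite aE// ThE mulrA sqE// -/(x t) (cosD (x t) (d t)); ring.
- have c : - ((q t * cos (d t) - r) * sin (x t)) - q t * sin (d t) * cos (x t)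
      @[t --> +oo] --> (- 0 - 0 : R).
    by apply: cvgB; [apply: cvgN|]; apply: cvg0_mul_bounded.
  rewrite !oppr0 addr0 in c.
  apply: cvg_trans c; apply: near_eq_cvg; near=> t.
  have t1 : 1 <= t by near: t; exact: nbhs_pinfty_ge.
  have t0 : 0 < t by lra.
  by rewrite bE// ThE mulrN mulrA sqE// -/(x t) (sinD (x t) (d t)); ring.
Unshelve. all: by end_near. Qed.

End PolarForm.

(** * Orthonormal expansions *)

Section InnerProduct.
Context {R : realType} {H : completeNormedModType R} {ip : {dot H for idfun}}.
Context (hip : norm_compatible ip).
Implicit Types (x y z : H) (c : R).

Lemma ipC x y : ip x y = ip y x.
Proof. by rewrite hermC expr0 mul1r. Qed.

Lemma ipDl x y z : ip (x + y) z = ip x z + ip y z.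
Proof. exact: linearDl. Qed.

Lemma ipZl c x z : ip (c *: x) z = c * ip x z.
Proof. exact: linearZl_LR. Qed.

Lemma ip0l z : ip 0 z = 0.
Proof. exact: linear0l. Qed.

Lemma ipBl x y z : ip (x - y) z = ip x z - ip y z.
Proof. by rewrite -scaleN1r ipDl ipZl mulN1r. Qed.

Lemma ipDr x y z : ip z (x + y) = ip z x + ip z y.
Proof. by rewrite !(ipC z) ipDl. Qed.

Lemma ipZr c x z : ip z (c *: x) = c * ip z x.
Proof. by rewrite !(ipC z) ipZl. Qed.

Lemma ipBr x y z : ip z (x - y) = ip z x - ip z y.
Proof. by rewrite !(ipC z) ipBl. Qed.

Lemma ip_suml I (r : seq I) (F : I -> H) z :
  ip (\sum_(i <- r) F i) z = \sum_(i <- r) ip (F i) z.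
Proof. exact: linear_sumlz. Qed.

Lemma ip_sumr I (r : seq I) (F : I -> H) z :
  ip z (\sum_(i <- r) F i) = \sum_(i <- r) ip z (F i).
Proof. by rewrite ipC ip_suml; apply: eq_bigr => i _; rewrite ipC. Qed.

Lemma norm_sub_sqr x y : `|x - y| ^+ 2 = `|x| ^+ 2 - 2 * ip x y + `|y| ^+ 2.
Proof. by rewrite -!hip ipBl !ipBr (ipC y x); ring. Qed.

Lemma cauchy_schwarz x y : `|ip x y| <= `|x| * `|y|.
Proof.
have [->|x0] := eqVneq x 0; first by rewrite ip0l normr0 mulr_ge0.
have [->|y0] := eqVneq y 0; first by rewrite ipC ip0l normr0 mulr_ge0.
have nx : 0 < `|x| by rewrite normr_gt0.
have ny : 0 < `|y| by rewrite normr_gt0.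
have nxy := mulr_gt0 nx ny.
have key c : c ^+ 2 = 1 -> c * ip x y <= `|x| * `|y|.
  move=> c2; have := sqr_ge0 `|(`|y| *: x) - (c * `|x|) *: y|.
  rewrite norm_sub_sqr !normrZ !normr_id ipZl ipZr.
  have -> : (`|c| * `|x| * `|y|) ^+ 2 = c ^+ 2 * (`|x| * `|y|) ^+ 2.
    by rewrite -mulrA exprMn real_normK// num_real.
  rewrite c2 => h; rewrite -(ler_pM2l nxy); lra.
rewrite ler_norml; have := key 1 (expr1n _ _); have := key (-1) (_ : (-1) ^+ 2 = 1).
by rewrite sqrrN expr1n => /(_ erefl) ? ?; apply/andP; split; lra.
Qed.

Lemma ip_continuous y : continuous (fun x : H => ip x y : R).
Proof.
move=> x; apply/cvgrPdist_le => eps eps0.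
have y1 : 0 < `|y| + 1 by rewrite ltr_wpDl.
near=> z; rewrite -ipBl; apply: (le_trans (cauchy_schwarz _ _)).
have xz : `|x - z| <= eps / (`|y| + 1).
  by near: z; apply: cvgr_dist_le => //; rewrite divr_gt0.
apply: (@le_trans _ _ (`|x - z| * (`|y| + 1))).
  by rewrite ler_wpM2l// lerDl.
by rewrite -ler_pdivlMr.
Unshelve. all: by end_near. Qed.

Lemma is_derive_ip (f : R -> H) (df y : H) (t : R) :
  is_derive t (1 : R) f df -> is_derive t (1 : R) (fun s => ip (f s) y : R) (ip df y : R).
Proof.
move=> [fd dfE].
have c : (fun h => h^-1 *: ((f \o shift t) (h *: (1 : R)) - f t)) @ 0^' --> df.
  by rewrite -dfE; exact: fd.
have c2 : (fun h => h^-1 *: (((fun s => ip (f s) y) \o shift t) (h *: (1 : R)) - ip (f t) y)) @ 0^'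
    --> (ip df y : R).
  rewrite (_ : (fun h => _) =
      (fun h => ip (h^-1 *: ((f \o shift t) (h *: (1 : R)) - f t)) y)).
    by apply: (cvg_comp _ (fun x : H => ip x y : R) c); exact: ip_continuous.
  by apply/funext => h; rewrite ipZl ipBl.
by split; [exact: (cvgP _ c2)|exact: (cvg_lim _ c2)].
Qed.

Section Basis.
Context {e : nat -> H} (he : orthonormal_basis ip e).

Lemma ip_basis i j : ip (e i) (e j) = (i == j)%:R.
Proof. by have [h _] := he. Qed.

Lemma norm_combination (r : seq nat) (c : nat -> R) : uniq r ->
  `|\sum_(k <- r) c k *: e k| ^+ 2 = \sum_(k <- r) c k ^+ 2.
Proof.
elim: r => [|i r IH] /=; first by rewrite !big_nil normr0 expr0n.
move=> /andP[ir ur]; rewrite !big_cons -IH// -!hip ipDl !ipDr !ipZl !ipZr.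
have orth : ip (\sum_(k <- r) c k *: e k) (e i) = 0.
  rewrite ip_suml big_seq big1// => k kr; rewrite ipZl ip_basis.
  by rewrite (_ : (k == i) = false) ?mulr0//; apply/negbTE; apply: contraNneq ir => <-.
by rewrite (ipC (e i) (\sum_(k <- r) c k *: e k)) orth ip_basis eqxx /=; ring.
Qed.

Lemma norm_sub_combination x (n : nat) (c : nat -> R) :
  `|x - \sum_(k < n) c k *: e k| ^+ 2 =
  `|x| ^+ 2 - \sum_(k < n) ip x (e k) ^+ 2 + \sum_(k < n) (c k - ip x (e k)) ^+ 2.
Proof.
rewrite norm_sub_sqr -(big_mkord xpredT (fun k => c k *: e k)).
rewrite norm_combination ?iota_uniq// ip_sumr big_mkord [X in _ + X = _]big_mkord.
rewrite mulr_sumr -addrA -[RHS]addrA; congr (_ + _).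
rewrite -!sumrN -!big_split /=; apply: eq_bigr => k _.
by rewrite ipZr; ring.
Qed.

Lemma bessel x n : \sum_(k < n) ip x (e k) ^+ 2 <= `|x| ^+ 2.
Proof.
have := sqr_ge0 `|x - \sum_(k < n) ip x (e k) *: e k|.
rewrite (norm_sub_combination x n (fun k => ip x (e k))).
rewrite [X in _ + X]big1 ?addr0 ?subr_ge0// => k _.
by rewrite subrr expr0n.
Qed.

(** Among the combinations of the first [m] basis vectors, the partial sum of the
    expansion is the best approximation. *)
Lemma partial_sum_dense x (eps : R) : 0 < eps -> exists n : nat, forall m, (n <= m)%N ->
  `|x - \sum_(k < m) ip x (e k) *: e k| <= eps.
Proof.
move=> eps0; have [_ hd] := he.
have [|y [/= xy [n [c yE]]]] := hd (ball x eps) _ (ball_open x eps).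
  by exists x; exact: ballxx.
exists n => m nm.
rewrite -(ler_sqr (normr_ge0 _) (ltW eps0)).
apply: (@le_trans _ _ (`|x - y| ^+ 2)); last first.
  rewrite ler_sqr ?nnegrE ?(ltW eps0)//.
  by move: xy; rewrite -ball_normE /= => /ltW.
rewrite yE (norm_sub_combination x n c) (norm_sub_combination x m (fun k => ip x (e k))).
rewrite [X in _ + X <= _]big1 ?addr0; last by move=> k _; rewrite subrr expr0n.
have : \sum_(k < n) ip x (e k) ^+ 2 <= \sum_(k < m) ip x (e k) ^+ 2.
  by apply: (partial_sum_mono (u := fun k => ip x (e k) ^+ 2)) => // k; exact: sqr_ge0.
have : 0 <= \sum_(k < n) (c k - ip x (e k)) ^+ 2 by apply: sumr_ge0 => k _; exact: sqr_ge0.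
by lra.
Qed.

Lemma parseval x : \sum_(k < n) ip x (e k) ^+ 2 @[n --> \oo] --> (`|x| ^+ 2 : R).
Proof.
apply/cvgrPdist_le => eps eps0.
have sq0 : 0 < Num.sqrt eps by rewrite sqrtr_gt0.
have [n Hn] := partial_sum_dense x sq0.
exists n => // m /= nm; have := Hn m nm.
rewrite -(ler_sqr (normr_ge0 _) (sqrtr_ge0 _)) (sqr_sqrtr (ltW eps0)).
rewrite (norm_sub_combination x m (fun k => ip x (e k))).
rewrite [X in _ + X <= _]big1 ?addr0; last by move=> k _; rewrite subrr expr0n.
by rewrite ger0_norm// subr_ge0 bessel.
Qed.

(** The combinations of the basis vectors are dense, and the bound makes the
    approximation uniform in time. *)
Lemma weak_cvg_of_components (v : R -> H) (C : R) :
  (forall t, 1 <= t -> `|v t| <= C) ->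
  (forall k, ip (v t) (e k) @[t --> +oo] --> (0 : R)) ->
  forall y, ip (v t) y @[t --> +oo] --> (0 : R).
Proof.
move=> vC vk y; apply/cvgrPdist_le => eps eps0.
have C1 : 0 < `|C| + 1 by rewrite ltr_wpDl.
have d0 : 0 < eps / 2 / (`|C| + 1) by rewrite !divr_gt0.
have [n Hn] := partial_sum_dense y d0; have {}Hn := Hn n (leqnn n).
pose z := \sum_(k < n) ip y (e k) *: e k.
have cz : ip (v t) z @[t --> +oo] --> (0 : R).
  have -> : (fun t => ip (v t) z) =
      (fun t => \sum_(k < n) ip y (e k) * ip (v t) (e k)).
    by apply/funext => t; rewrite ip_sumr; apply: eq_bigr => k _; rewrite ipZr.
  elim: n {z Hn} => [|n IH]; first by under eq_fun do rewrite big_ord0; exact: cvg_cst.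
  under eq_fun do rewrite big_ord_recr /=.
  have c1 : ip y (e n) * ip (v t) (e n) @[t --> +oo] --> (ip y (e n) * 0 : R).
    exact: cvgMr.
  by have := cvgD IH c1; rewrite mulr0 addr0; apply.
have eps2 : 0 < eps / 2 by lra.
have cz2 : \forall t \near +oo, `|ip (v t) z| <= eps / 2.
  by move/cvgrPdist_le : cz => /(_ _ eps2); apply: filterS => t; rewrite sub0r normrN.
near=> t; rewrite sub0r normrN.
have -> : ip (v t) y = ip (v t) z + ip (v t) (y - z) by rewrite -ipDr addrC subrK.
apply: (le_trans (ler_normD _ _)).
have vt : `|v t| <= `|C| + 1.
  have : `|v t| <= C by apply: vC; near: t; exact: nbhs_pinfty_ge.
  by have := ler_norm C; lra.
have h1 : `|ip (v t) z| <= eps / 2 by near: t.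
have h2 : `|ip (v t) (y - z)| <= eps / 2.
  apply: (le_trans (cauchy_schwarz _ _)).
  apply: (@le_trans _ _ ((`|C| + 1) * (eps / 2 / (`|C| + 1)))).
    by apply: ler_pM.
  by rewrite mulrC divfK// gt_eqF.
by lra.
Unshelve. all: by end_near. Qed.

Section SquareRoot.
Context {lambda : nat -> R}.
Local Notation half := (sqrt_op ip e lambda).

(** By orthogonality, the Cauchy condition for the vectors is the one for the
    squares of their coefficients. *)
Lemma sqrt_op_cvg x : sqrt_dom ip e lambda x ->
  series (fun k => (lambda k * ip x (e k)) *: e k) @ \oo --> half x.
Proof.
rewrite /sqrt_dom /= => /cvg_cauchy/cauchy_seriesP hx.
suff : cvgn (series (fun k => (lambda k * ip x (e k)) *: e k)) by [].
apply/cauchy_cvgP/cauchy_seriesP => eps eps0.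
have := hx (eps ^+ 2) (exprn_gt0 2 eps0); apply: filterS => -[m n] /=.
rewrite -(ltr_sqr (normr_ge0 _) (ltW eps0)) norm_combination ?iota_uniq//.
move=> h; under eq_bigr do rewrite exprMn.
exact: le_lt_trans (ler_norm _) h.
Qed.

Lemma ip_sqrt_op x k : sqrt_dom ip e lambda x ->
  ip (half x) (e k) = lambda k * ip x (e k).
Proof.
move=> hx.
have c1 : ip (series (fun k => (lambda k * ip x (e k)) *: e k) n) (e k) @[n --> \oo]
    --> (ip (half x) (e k) : R).
  by apply: (cvg_comp _ (fun z : H => ip z (e k) : R) (sqrt_op_cvg hx)); exact: ip_continuous.
have c2 : ip (series (fun k => (lambda k * ip x (e k)) *: e k) n) (e k) @[n --> \oo]
    --> (lambda k * ip x (e k) : R).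
  apply: (@cvg_near_cst nat R); exists k.+1 => // n /= kn.
  rewrite /series /= big_mkord ip_suml (bigD1 (Ordinal kn))//= ipZl ip_basis eqxx mulr1.
  rewrite big1 ?addr0// => i ik; rewrite ipZl ip_basis.
  by rewrite (_ : (nat_of_ord i == k) = false) ?mulr0//; apply/negbTE.
exact: cvg_unique c1 c2.
Qed.

Lemma sqrt_op_eq x y : sqrt_dom ip e lambda x ->
  (forall k, ip y (e k) = lambda k * ip x (e k)) -> half x = y.
Proof.
move=> hx hy; apply/eqP; rewrite -subr_eq0 -normr_eq0 -sqrf_eq0; apply/eqP.
have c := @parseval (half x - y).
suff c0 : \sum_(k < n) ip (half x - y) (e k) ^+ 2 @[n --> \oo] --> (0 : R).
  exact: cvg_unique c c0.
apply: (@cvg_near_cst nat R); near=> n.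
by rewrite big1// => k _; rewrite ipBl ip_sqrt_op// hy subrr expr0n.
Unshelve. all: by end_near. Qed.

Lemma sqrt_domZ c x : sqrt_dom ip e lambda x -> sqrt_dom ip e lambda (c *: x).
Proof.
rewrite /sqrt_dom /= => hx.
have -> : (fun k => lambda k ^+ 2 * ip (c *: x) (e k) ^+ 2) =
    c ^+ 2 *: (fun k => lambda k ^+ 2 * ip x (e k) ^+ 2).
  by apply/funext => k; rewrite /= ipZl exprMn mulrCA.
exact: is_cvg_seriesZ.
Qed.

Lemma sqrt_opZ c x : sqrt_dom ip e lambda x -> half (c *: x) = c *: half x.
Proof.
move=> hx; apply: sqrt_op_eq; first exact: sqrt_domZ.
by move=> k; rewrite !ipZl ip_sqrt_op// mulrCA.
Qed.

Lemma sqrt_dom0 : sqrt_dom ip e lambda 0.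
Proof.
apply/cvg_ex; exists 0.
apply: (@cvg_near_cst nat R); near=> n.
by rewrite /series /= big1// => k _; rewrite ip0l expr0n mulr0.
Unshelve. all: by end_near. Qed.

Lemma sqrt_op0 : half 0 = 0.
Proof. by apply: sqrt_op_eq sqrt_dom0 _ => k; rewrite !ip0l mulr0. Qed.

End SquareRoot.
End Basis.
End InnerProduct.

(** * From the weak solution to its modes *)

Section InitialInstant.
Context {R : realType}.

Lemma halfline_right_cvg (V : normedModType R) (f df : R -> V) :
  derivative_on_halfline f df -> f h @[h --> 0^'+] --> f 0.
Proof.
move=> [_ c].
have hid : (h : R) @[h --> (0 : R)^'+] --> (0 : R).
  by apply: cvg_at_right_filter; exact: cvg_id.
have c1 : f 0 + h *: (h^-1 *: (f h - f 0)) @[h --> (0 : R)^'+] --> f 0 + 0 *: df 0.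
  by apply: cvgD; [exact: cvg_cst|exact: cvgZ].
rewrite scale0r addr0 in c1; apply: cvg_trans c1; apply: near_eq_cvg; near=> h.
have h0 : h != 0 by rewrite gt_eqF//; near: h; exact: nbhs_right_gt.
by rewrite scalerA mulfV// scale1r addrC subrK.
Unshelve. all: by end_near. Qed.

Context {lam : nat -> R} {a b : nat -> R -> R} {g E : R -> R}.
Context (S : damped_modes lam a b g E) (k : nat) (e0 : R).
Context (init : (a k t ^+ 2 + b k t ^+ 2) @[t --> 0^'+] --> e0).

(** e_k is nonincreasing on the open half-line; comparison with its right limit
    shows that modes initially at rest remain at rest. *)
Lemma mode_energy_le_initial t : 0 < t -> a k t ^+ 2 + b k t ^+ 2 <= e0.
Proof.
move=> t0; apply: (cvgr_to_ge init); near=> s.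
have s0 : 0 < s by near: s; exact: nbhs_right_gt.
have st : s <= t by near: s; exact: nbhs_right_le.
apply: (deriv_le0_nonincreasing (mode_energy_deriv S k) _ s0 st) => x /andP[sx _].
have := damping_ge0 S (lt_le_trans s0 sx); have := sqr_ge0 (b k x); nra.
Unshelve. all: by end_near. Qed.

(** Backward uniqueness: e_k' >= - 2 K e_k when g <= K. *)
Lemma mode_energy_stays_positive (K : R) : (forall t, 0 < t -> g t <= K) -> 0 < e0 ->
  forall t, 0 < t -> 0 < a k t ^+ 2 + b k t ^+ 2.
Proof.
move=> gK e0_gt0 t t0.
pose f s := (a k s ^+ 2 + b k s ^+ 2) * expR (2 * K * s).
have df : has_deriv f (fun s => expR (2 * K * s) *
    (2 * K * (a k s ^+ 2 + b k s ^+ 2) - 2 * g s * b k s ^+ 2)).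
  by have Da := dm_a S k; have Db := dm_b S k; rewrite /f => s s0; derive_as; rewrite /=; ring.
have cf : f s @[s --> 0^'+] --> e0.
  have cexp : expR (2 * K * s) @[s --> (0 : R)^'+] --> expR (2 * K * 0).
    apply: cvg_at_right_filter.
    have dexp : is_derive (0 : R) (1 : R) (fun s => expR (2 * K * s)) (expR (2 * K * 0) * (2 * K)).
      by derive_as; ring.
    by move: dexp => [/derivable1_diffP/differentiable_continuous].
  have := cvgM init cexp.
  by rewrite mulr0 expR0 mulr1; apply.
suff : e0 <= f t.
  by rewrite /f => h; have := lt_le_trans e0_gt0 h; rewrite pmulr_lgt0// expR_gt0.
apply: (cvgr_to_le cf); near=> s.
have s0 : 0 < s by near: s; exact: nbhs_right_gt.
have st : s <= t by near: s; exact: nbhs_right_le.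
apply: (deriv_ge0_nondecreasing df _ s0 st) => x /andP[sx _].
have x0 : 0 < x by exact: lt_le_trans sx.
rewrite mulr_ge0 ?expR_ge0//.
have h1 : g x * b k x ^+ 2 <= K * b k x ^+ 2 by rewrite ler_wpM2r ?sqr_ge0 ?gK.
have K0 : 0 <= K by exact: le_trans (damping_ge0 S x0) (gK x x0).
have h2 := mulr_ge0 K0 (sqr_ge0 (a k x)).
lra.
Unshelve. all: by end_near. Qed.

End InitialInstant.

Section WeakSolution.
Context {R : realType} {H : completeNormedModType R} {ip : {dot H for idfun}}.
Context (hip : norm_compatible ip) {DA : set H} {A : H -> H}.
Context {e : nat -> H} {lambda : nat -> R} (he : orthonormal_basis ip e).
Context (hlambda_pos : forall k, 0 < lambda k).
Context (hlambda_incr : forall k l, (k < l)%N -> lambda k < lambda l).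
Context (heig : forall k, DA (e k) /\ A (e k) = lambda k ^+ 2 *: e k).
Context {u0 u1 : H} {u du : R -> H}.
Context (hu : weak_solution ip e lambda DA A u0 u1 u du).

Local Notation half := (sqrt_op ip e lambda).
Local Notation E := (energy ip e lambda u du).
Local Notation a := (fun i t => lambda i * ip (u t) (e i)).
Local Notation b := (fun i t => ip (du t) (e i)).

Lemma energy_within_continuous : {within `[0, +oo[, continuous E}.
Proof.
have cdu := weak_sol_deriv_cont hu; have cS := weak_sol_sqrt_cont hu.
rewrite (_ : E = fun t => `|du t| * `|du t| + `|half (u t)| * `|half (u t)|); last first.
  by apply/funext => t; rewrite /energy !expr2.
by move=> x; apply: cvgD; apply: cvgM; apply: cvg_norm; [exact: cdu|exact: cdu|exact: cS|exact: cS].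
Qed.

Lemma kinetic_within_continuous : {within `[0, +oo[, continuous (fun t => `|du t| ^+ 2)}.
Proof.
have cdu := weak_sol_deriv_cont hu.
rewrite (_ : (fun t => _) = fun t => `|du t| * `|du t|); last first.
  by apply/funext => t; rewrite expr2.
by move=> x; apply: cvgM; apply: cvg_norm; exact: cdu.
Qed.

Lemma weak_solution_modes : damped_modes lambda a b (fun t => `|du t| ^+ 2) E.
Proof.
split => //.
- move=> i t t0; have [/(_ t t0) d _] := weak_sol_deriv hu.
  have d' := is_derive_ip hip (e i) d.
  suff : is_derive t (1 : R) (fun t => lambda i * ip (u t) (e i))
    (lambda i * ip (du t) (e i)) by [].
  by derive_as; ring.
- move=> i t t0; have [Di Ai] := heig i.
  have [/(_ t t0) d _] := weak_sol_eq hu Di.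
  apply: is_derive_eq d _.
  by rewrite Ai ipZr; ring.
- by move=> t t0; exact: (parseval hip he).
- move=> t t0; have domt := weak_sol_dom hu (ltW t0).
  have c := cvgD (parseval hip he (x := half (u t))) (parseval hip he (x := du t)).
  rewrite /energy [X in _ --> X]addrC.
  suff -> : (fun n => \sum_(i < n) ((lambda i * ip (u t) (e i)) ^+ 2 + ip (du t) (e i) ^+ 2))
     = (fun n => \sum_(i < n) ip (half (u t)) (e i) ^+ 2 + \sum_(i < n) ip (du t) (e i) ^+ 2).
    exact: c.
  apply/funext => n; rewrite -big_split; apply: eq_bigr => i _.
  by rewrite (ip_sqrt_op hip he).
- by move=> t t0; have /continuous_within_itvcyP[h _] := kinetic_within_continuous;
    apply: h; rewrite in_itv/= t0.
- by move=> t t0; have /continuous_within_itvcyP[h _] := energy_within_continuous;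
    apply: h; rewrite in_itv/= t0.
Qed.

(** E is nonincreasing and right-continuous at the initial instant; this bounds the
    damping coefficient up to the initial instant. *)
Lemma kinetic_le_initial t : 0 < t -> `|du t| ^+ 2 <= E 0.
Proof.
move=> t0; have S := weak_solution_modes.
apply: le_trans (damping_le_energy S t0) _.
have /continuous_within_itvcyP[_ c] := energy_within_continuous.
apply: (cvgr_to_ge c); near=> s.
apply: (energy_nonincreasing S).
  by near: s; exact: nbhs_right_gt.
by near: s; exact: nbhs_right_le.
Unshelve. all: by end_near. Qed.

Lemma mode_energy_initial k : ((lambda k * ip (u t) (e k)) ^+ 2 + ip (du t) (e k) ^+ 2)
  @[t --> 0^'+] --> ((lambda k * ip u0 (e k)) ^+ 2 + ip u1 (e k) ^+ 2 : R).
Proof.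
have cu := halfline_right_cvg (weak_sol_deriv hu).
have [Dk _] := heig k; have cdu := halfline_right_cvg (weak_sol_eq hu Dk).
rewrite (weak_sol_init0 hu) in cu; rewrite (weak_sol_init1 hu) in cdu.
have cu2 : ip (u t) (e k) @[t --> 0^'+] --> (ip u0 (e k) : R).
  by apply: (cvg_comp _ (fun z : H => ip z (e k) : R) cu); exact: (ip_continuous hip).
apply: cvgD; under [X in X @ _ --> _]eq_fun do rewrite expr2; rewrite expr2.
  by apply: cvgM; apply: cvgMr.
by apply: cvgM.
Qed.

Lemma active_modesP k : active_modes ip e u0 u1 k <->
  0 < (lambda k * ip u0 (e k)) ^+ 2 + ip u1 (e k) ^+ 2.
Proof.
have l2 : 0 < lambda k ^+ 2 by rewrite exprn_gt0.
have p0 := sqr_ge0 (ip u0 (e k)); have p1 := sqr_ge0 (ip u1 (e k)).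
rewrite /active_modes /= exprMn; split => [|h].
  have [-> |n1 _] := eqVneq (ip u1 (e k) ^+ 2) 0.
    by rewrite add0r addr0 => n0; apply: mulr_gt0 => //; rewrite lt_def n0.
  by apply: ltr_wpDl; [rewrite mulr_ge0// ltW|rewrite lt_def n1].
apply/negP => /eqP s0; have z0 : ip u0 (e k) ^+ 2 = 0 by lra.
have z1 : ip u1 (e k) ^+ 2 = 0 by lra.
by move: h; rewrite z0 z1 mulr0 addr0 ltxx.
Qed.

Lemma active_mode_gt0 k : active_modes ip e u0 u1 k ->
  forall t, 0 < t -> 0 < (lambda k * ip (u t) (e k)) ^+ 2 + ip (du t) (e k) ^+ 2.
Proof.
move=> /active_modesP h t t0.
exact: (mode_energy_stays_positive weak_solution_modes (@mode_energy_initial k) kinetic_le_initial h t0).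
Qed.

Lemma inactive_mode0 k : ~ active_modes ip e u0 u1 k ->
  forall t, 0 < t -> lambda k * ip (u t) (e k) = 0 /\ ip (du t) (e k) = 0.
Proof.
move=> nJ t t0.
have := mode_energy_le_initial weak_solution_modes (@mode_energy_initial k) t0.
have -> : (lambda k * ip u0 (e k)) ^+ 2 + ip u1 (e k) ^+ 2 = 0.
  apply/eqP; rewrite eq_le addr_ge0 ?sqr_ge0// andbT leNgt; apply/negP.
  by move=> /active_modesP.
move=> le0; split; apply/eqP; rewrite -sqrf_eq0 eq_le sqr_ge0 andbT.
  by apply: le_trans le0; rewrite lerDl sqr_ge0.
by apply: le_trans le0; rewrite lerDr sqr_ge0.
Qed.

(** The smallest frequency is [lambda 0]. *)
Lemma position_le_half x : sqrt_dom ip e lambda x ->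
  lambda 0%N ^+ 2 * `|x| ^+ 2 <= `|half x| ^+ 2.
Proof.
move=> hx; have l0 := hlambda_pos 0.
have c : lambda 0%N ^+ 2 * (\sum_(k < n) ip x (e k) ^+ 2) @[n --> \oo] -->
    (lambda 0%N ^+ 2 * `|x| ^+ 2 : R).
  by apply: cvgMr; exact: (parseval hip he).
apply: (cvgr_to_le c); near=> n.
apply: le_trans (bessel hip he (half x) n).
rewrite mulr_sumr; apply: ler_sum => k _; rewrite (ip_sqrt_op hip he)// exprMn.
rewrite ler_wpM2r ?sqr_ge0// ler_sqr ?nnegrE ?(ltW (hlambda_pos _))//.
by case: (nat_of_ord k) => [|m]; [exact: lexx|exact/ltW/hlambda_incr].
Unshelve. all: by end_near. Qed.

End WeakSolution.

(** * Counting active modes *)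

Section Counting.

Lemma count_finite_set (J : set nat) (j : nat) : (J #= `I_j)%card ->
  exists2 N : nat, forall i, J i -> (i < N)%N & (\sum_(i < N) `[< J i >])%N = j.
Proof.
move=> Jj; have finJ : finite_set J by exists j.
pose s := finmap.enum_fset (fset_set J).
have sj : size s = j := card_fset_set Jj.
have us : uniq s by exact: finmap.fset_uniq.
have sP i : (i \in s) = `[< J i >].
  exact: (in_fset_set finJ i).
pose N := (\max_(i <- s) i).+1.
have sN i : i \in s -> (i < N)%N.
  by move=> si; rewrite ltnS; exact: (leq_bigmax_seq (P := xpredT) (F := fun i => i) i si isT).
exists N; first by move=> i Ji; apply: sN; rewrite sP; exact/asboolP.
rewrite -(big_mkord xpredT (fun i => nat_of_bool `[< J i >])) -sj.
rewrite -sum1_size (eq_bigr (fun i => if `[< J i >] then 1 else 0)%N); last first.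
  by move=> i _; case: asboolP.
rewrite -big_mkcond /= -big_filter; apply: perm_big.
apply: uniq_perm => //; first by rewrite filter_uniq// iota_uniq.
move=> i; rewrite mem_filter mem_index_iota sP /=.
by case: asboolP => //= Ji; apply: sN; rewrite sP; exact/asboolP.
Qed.

Lemma count_infinite_set (J : set nat) : infinite_set J ->
  forall n, exists N : nat, (n <= \sum_(i < N) `[< J i >])%N.
Proof.
move=> infJ; elim=> [|n [N HN]]; first by exists 0%N.
have [i Ni Ji] : exists2 i, (N <= i)%N & J i.
  apply: contrapT => no; apply: infJ; apply: (sub_finite_set _ (finite_II N)).
  by move=> i Ji /=; rewrite ltnNge; apply/negP => Ni; apply: no; exists i.
exists i.+1; rewrite big_ord_recr /= (asboolT Ji) addn1 ltnS.
apply: (leq_trans HN); rewrite -!(big_mkord xpredT (fun i => nat_of_bool `[< J i >])).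
by rewrite (big_cat_nat (n := N) (p := i))//= leq_addr.
Qed.

End Counting.

(** * Quantized energy decay *)

Unset Implicit Arguments.

Theorem theorem2p1 (R : realType) (H : completeNormedModType R)
    (ip : {dot H for idfun}) (hip : norm_compatible ip)
    (DA : set H) (A : H -> H)
    (hAlin : linear_operator DA A) (hAdense : dense DA)
    (hAsa : self_adjoint ip DA A)
    (e : nat -> H) (lambda : nat -> R)
    (he : orthonormal_basis ip e)
    (hlambda_pos : forall k, 0 < lambda k)
    (hlambda_incr : forall k l, (k < l)%N -> lambda k < lambda l)
    (heig : forall k, DA (e k) /\ A (e k) = lambda k ^+ 2 *: e k)
    (u0 u1 : H) (hu0 : sqrt_dom ip e lambda u0)
    (u du : R -> H)
    (hu : weak_solution ip e lambda DA A u0 u1 u du) :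
  let J := active_modes ip e u0 u1 in
  let E := energy ip e lambda u du in
  let uk k t := ip (u t) (e k) in
  let duk k t := ip (du t) (e k) in
  [/\ (J = set0 ->
        (forall t, 0 <= t -> u t = 0) /\
        t * E t @[t --> +oo] --> (0 : R)),
      (forall j : nat, (0 < j)%N -> (J #= `I_j)%card ->
        [/\ forall k, ~ J k -> forall t, 0 <= t -> uk k t = 0,
            forall k, J k -> exists theta : R,
              (Num.sqrt t * uk k t
                - 2 / Num.sqrt (2 * j%:R + 1)
                  * (cos (lambda k * t + theta) / lambda k))
                @[t --> +oo] --> (0 : R) /\
              (Num.sqrt t * duk k t
                + 2 / Num.sqrt (2 * j%:R + 1) * sin (lambda k * t + theta))
                @[t --> +oo] --> (0 : R)
          & t * E t @[t --> +oo] --> (4 * j%:R / (2 * j%:R + 1) : R)])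
    & (infinite_set J ->
        [/\ forall k, t * (`|duk k t| ^+ 2 + lambda k ^+ 2 * `|uk k t| ^+ 2)
              @[t --> +oo] --> (0 : R),
            (0 < limf_einf (fun t : R => (t * E t)%:E) +oo%R)%E,
            phase_weak_cvg ip e lambda
              (fun t => Num.sqrt t *: (u t, du t)) (0, 0)
          & ~ phase_strong_cvg ip e lambda
              (fun t => Num.sqrt t *: (u t, du t)) (0, 0)])].
Proof.
set J := active_modes ip e u0 u1; move=> J' E uk duk; rewrite {}/J'.
pose a i t := lambda i * ip (u t) (e i); pose b i t := ip (du t) (e i).
pose en i t := a i t ^+ 2 + b i t ^+ 2.
have S : damped_modes lambda a b (fun t => `|du t| ^+ 2) E.
  exact: (weak_solution_modes hip he hlambda_pos hlambda_incr heig hu).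
have active k : J k -> forall t, 0 < t -> 0 < en k t.
  exact: (active_mode_gt0 hip he hlambda_pos hlambda_incr heig hu).
have inactive k : ~ J k -> forall t, 0 < t -> a k t = 0 /\ b k t = 0.
  exact: (inactive_mode0 hip he hlambda_pos hlambda_incr heig hu).
have inactive_u k : ~ J k -> forall t, 0 <= t -> uk k t = 0.
  move=> nJ t; rewrite le_eqVlt => /predU1P[<-|t0].
    rewrite /uk (weak_sol_init0 hu); apply/eqP; rewrite -sqrf_eq0.
    apply/eqP; apply: contra_notP nJ => /eqP n0; rewrite /J /active_modes /=.
    by rewrite paddr_eq0 ?sqr_ge0// negb_and n0 orbT.
  have [/eqP] := inactive k nJ t t0; rewrite mulf_eq0 => /orP[/eqP l0|/eqP//] _.
  by have := hlambda_pos k; rewrite l0 ltxx.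
have inactive_en k : ~ J k -> forall t, 0 < t -> en k t = 0.
  by move=> nJ t t0; have [z1 z2] := inactive k nJ t t0; rewrite /en z1 z2 expr0n addr0.
pose act : pred nat := fun k => `[< J k >].
have actP k : act k -> forall t, 0 < t -> 0 < en k t by move=> /asboolP/active.
have inactP k : ~~ act k -> forall t, 0 < t -> a k t = 0 /\ b k t = 0.
  by move=> /asboolPn/inactive.
have EE t : 0 < t -> \sum_(i < n) en i t @[n --> \oo] --> E t := dm_E S (t := t).
split.
- move=> J0; have nJ k : ~ J k by rewrite J0.
  split.
    move=> t t0; apply/eqP; rewrite -normr_eq0 -sqrf_eq0; apply/eqP.
    suff c : \sum_(k < n) ip (u t) (e k) ^+ 2 @[n --> \oo] --> (0 : R).
      exact: cvg_unique (parseval hip he (x := u t)) c.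
    apply: (@cvg_near_cst nat R); near=> n.
    by rewrite big1// => k _; have := inactive_u k (nJ k) t t0; rewrite /uk => ->; rewrite expr0n.
  apply: (@cvg_near_cst R R); near=> t.
  have t0 : 0 < t by near: t; exact: nbhs_pinfty_gt.
  suff -> : E t = 0 by rewrite mulr0.
  suff c : \sum_(i < n) en i t @[n --> \oo] --> (0 : R) by exact: cvg_unique (EE t t0) c.
  by apply: (@cvg_near_cst nat R); near=> n; rewrite big1// => k _; exact: inactive_en.
- move=> j j0 Jj; have [N JN Nj] := count_finite_set Jj.
  have actN k : act k -> (k < N)%N by move=> /asboolP/JN.
  have D0 : 0 < 2 * j%:R + 1 :> R by rewrite ltr_wpDl// mulr_ge0.
  have rate k : J k -> t * en k t @[t --> +oo] --> (4 / (2 * j%:R + 1) : R).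
    move=> Jk; apply: (finite_modes_rate S actP inactP actN Nj).
    exact/asboolP.
  split; first exact: inactive_u.
  + move=> k Jk; pose r : R := 2 / Num.sqrt (2 * j%:R + 1).
    have r0 : 0 <= r by rewrite divr_ge0// sqrtr_ge0.
    have r2 : r ^+ 2 = 4 / (2 * j%:R + 1).
      by rewrite /r expr_div_n sqr_sqrtr ?ltW// -natrX.
    have [|theta [c1 c2]] := polar_asymptotics S (active k Jk) r0.
      by rewrite r2; exact: rate.
    exists theta; split => //.
    have lk := hlambda_pos k.
    have c : (Num.sqrt t * a k t - r * cos (lambda k * t + theta)) / lambda k
        @[t --> +oo] --> (0 / lambda k : R) by exact: cvgMl.
    rewrite mul0r in c.
    suff -> : (fun t => Num.sqrt t * uk k t - 2 / Num.sqrt (2 * j%:R + 1)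
                  * (cos (lambda k * t + theta) / lambda k)) =
        (fun t => (Num.sqrt t * a k t - r * cos (lambda k * t + theta)) / lambda k) by [].
    apply/funext => t; rewrite /a /uk /r; field.
    by rewrite !gt_eqF// sqrtr_gt0.
  + have EN t : 0 < t -> E t = \sum_(i < N) en i t.
      move=> t0; suff c : \sum_(i < n) en i t @[n --> \oo] --> \sum_(i < N) en i t.
        exact: cvg_unique (EE t t0) c.
      apply: (stationary_sums_cvg (u := fun i => en i t)) => i Ni.
      by apply: inactive_en => // /JN; rewrite ltnNge Ni.
    have sumrate n : \sum_(i < n) t * en i t @[t --> +oo] -->
        (\sum_(i < n) (act i)%:R * (4 / (2 * j%:R + 1)) : R).
      elim: n => [|n IH].
        rewrite big_ord0; under eq_fun do rewrite big_ord0; exact: cvg_cst.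
      rewrite big_ord_recr /=; under eq_fun do rewrite big_ord_recr /=.
      apply: cvgD => //; have [/asboolP/rate|nJ] := boolP (act n); first by rewrite mul1r.
      rewrite mul0r; apply: (@cvg_near_cst R R); near=> t.
      have t0 : 0 < t by near: t; exact: nbhs_pinfty_gt.
      by rewrite inactive_en ?mulr0//; exact/asboolPn.
    have limE : \sum_(i < N) (act i)%:R * (4 / (2 * j%:R + 1)) = 4 * j%:R / (2 * j%:R + 1) :> R.
      by rewrite -mulr_suml -natr_sum Nj; ring.
    have := sumrate N; rewrite limE => c; apply: cvg_trans c; apply: near_eq_cvg; near=> t.
    have t0 : 0 < t by near: t; exact: nbhs_pinfty_gt.
    by rewrite EN// mulr_sumr.
- move=> infJ; have cnt := count_infinite_set infJ.
  have rate k : t * en k t @[t --> +oo] --> (0 : R).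
    have [ak|nk] := boolP (act k); first exact: (infinite_modes_rate S actP inactP cnt ak).
    apply: (@cvg_near_cst R R); near=> t.
    have t0 : 0 < t by near: t; exact: nbhs_pinfty_gt.
    by rewrite inactive_en ?mulr0//; exact/asboolPn.
  have [k Jk] : exists k, J k.
    apply: contrapT => noJ; apply: infJ.
    suff -> : J = set0 by exact: finite_set0.
    by apply/seteqP; split => // k Jk; apply: noJ; exists k.
  have Epos := active_energy_gt0 S (active k Jk).
  have [c c0 cE] := energy_ge_inv S Epos.
  have [C CE] := energy_le_inv S Epos.
  have dom t : 1 <= t -> sqrt_dom ip e lambda (u t).
    by move=> t1; apply: (weak_sol_dom hu); lra.
  have sqrt_bound (v : R -> H) (K : R) : (forall t, 1 <= t -> t * `|v t| ^+ 2 <= K) ->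
      forall t, 1 <= t -> `|Num.sqrt t *: v t| <= Num.sqrt K.
    move=> vK t t1; have t0 : 0 <= t by lra.
    have K0 : 0 <= K by apply: le_trans (vK t t1); rewrite mulr_ge0 ?sqr_ge0.
    rewrite -(ler_sqr (normr_ge0 _) (sqrtr_ge0 _)) sqr_sqrtr// normrZ exprMn.
    by rewrite real_normK ?num_real// sqr_sqrtr// vK.
  have du_le t : `|du t| ^+ 2 <= E t by rewrite /E /energy lerDl sqr_ge0.
  have Su_le t : `|sqrt_op ip e lambda (u t)| ^+ 2 <= E t by rewrite /E /energy lerDr sqr_ge0.
  have a_cvg i : Num.sqrt t * a i t @[t --> +oo] --> (0 : R).
    apply: cvg0_of_sqr_le (rate i); near=> t.
    have t0 : 0 <= t by apply: ltW; near: t; exact: nbhs_pinfty_gt.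
    by rewrite exprMn sqr_sqrtr// ler_wpM2l// /en lerDl sqr_ge0.
  have b_cvg i : Num.sqrt t * b i t @[t --> +oo] --> (0 : R).
    apply: cvg0_of_sqr_le (rate i); near=> t.
    have t0 : 0 <= t by apply: ltW; near: t; exact: nbhs_pinfty_gt.
    by rewrite exprMn sqr_sqrtr// ler_wpM2l// /en lerDr sqr_ge0.
  split.
  + move=> i; suff -> : (fun t => t * (`|duk i t| ^+ 2 + lambda i ^+ 2 * `|uk i t| ^+ 2)) =
      (fun t => t * en i t) by exact: rate.
    apply/funext => t; rewrite !real_normK ?num_real// /en /a /b exprMn.
    by rewrite [in RHS]addrC.
  + exact: limf_einf_gt0 c0 cE.
  + move=> w dw.
    have -> : phase_ip ip e lambda (0, 0) w = 0.
      by rewrite /phase_ip /= (sqrt_op0 hip he) !ip0l !addr0.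
    have l0 : 0 < lambda 0%N ^+ 2 by rewrite exprn_gt0.
    have weak_u : ip (Num.sqrt t *: u t) w.1 @[t --> +oo] --> (0 : R).
      apply: (weak_cvg_of_components hip he (C := Num.sqrt (C / lambda 0%N ^+ 2))).
        apply: sqrt_bound => t t1; rewrite ler_pdivlMr//.
        have := position_le_half hip he hlambda_pos hlambda_incr (dom t t1).
        have := CE t t1; have := Su_le t => h1 h2 h3.
        have : t * (lambda 0%N ^+ 2 * `|u t| ^+ 2) <= t * E t.
          by apply: ler_wpM2l; [lra|exact: le_trans h3 h1].
        lra.
      move=> i; have li := hlambda_pos i.
      have ci : Num.sqrt t * a i t / lambda i @[t --> +oo] --> (0 / lambda i : R).
        exact: cvgMl.
      rewrite mul0r in ci.
      suff -> : (fun t => ip (Num.sqrt t *: u t) (e i)) =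
        (fun t => Num.sqrt t * a i t / lambda i) by [].
      by apply/funext => t; rewrite ipZl /a; field; rewrite gt_eqF.
    have weak_S : ip (Num.sqrt t *: sqrt_op ip e lambda (u t)) (sqrt_op ip e lambda w.1)
        @[t --> +oo] --> (0 : R).
      apply: (weak_cvg_of_components hip he (C := Num.sqrt C)).
        apply: sqrt_bound => t t1; apply: le_trans (CE t t1).
        by apply: ler_wpM2l; [lra|exact: Su_le].
      move=> i; have ci := a_cvg i; apply: cvg_trans ci; apply: near_eq_cvg; near=> t.
      have t1 : 1 <= t by near: t; exact: nbhs_pinfty_ge.
      by rewrite ipZl (ip_sqrt_op hip he i (dom t t1)).
    have weak_du : ip (Num.sqrt t *: du t) w.2 @[t --> +oo] --> (0 : R).
      apply: (weak_cvg_of_components hip he (C := Num.sqrt C)).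
        apply: sqrt_bound => t t1; apply: le_trans (CE t t1).
        by apply: ler_wpM2l; [lra|exact: du_le].
      move=> i; suff -> : (fun t => ip (Num.sqrt t *: du t) (e i)) =
        (fun t => Num.sqrt t * b i t) by exact: b_cvg.
      by apply/funext => t; rewrite ipZl.
    have cw : ip (Num.sqrt t *: u t) w.1
        + ip (Num.sqrt t *: sqrt_op ip e lambda (u t)) (sqrt_op ip e lambda w.1)
        + ip (Num.sqrt t *: du t) w.2 @[t --> +oo] --> (0 + 0 + 0 : R).
      by apply: cvgD => //; exact: cvgD.
    rewrite !addr0 in cw.
    apply: cvg_trans cw; apply: near_eq_cvg; near=> t.
    have t1 : 1 <= t by near: t; exact: nbhs_pinfty_ge.
    by rewrite /phase_ip /= (sqrt_opZ hip he _ (dom t t1)).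
  + rewrite /phase_strong_cvg => strong.
    have sc : 0 < Num.sqrt c by rewrite sqrtr_gt0.
    have small : \forall t \near +oo,
        phase_norm ip e lambda (Num.sqrt t *: (u t, du t) - (0, 0)) < Num.sqrt c.
      exact: (cvgr_lt _ strong).
    have [T [_ HT]] := small.
    pose t := Num.max T 0 + 1.
    have t1 : 1 <= t by rewrite lerDr le_max lexx orbT.
    have t0 : 0 <= t by lra.
    have := HT t; rewrite (_ : T < t); last first.
      by rewrite (@le_lt_trans _ _ (Num.max T 0))// ?ltrDl// le_max lexx.
    move=> /(_ isT); rewrite (_ : (0, 0) = 0 :> H * H)// subr0 ltNge => /negP; apply.
    rewrite ler_sqrt; last first.
      by rewrite /phase_ip !addr_ge0// hip sqr_ge0.
    apply: (le_trans (cE t t1)).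
    rewrite /phase_ip /= (sqrt_opZ hip he _ (dom t t1)) !hip !normrZ !exprMn.
    rewrite real_normK ?num_real// sqr_sqrtr// /E /energy.
    have := mulr_ge0 t0 (sqr_ge0 `|u t|); lra.
Unshelve. all: by end_near. Qed.
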